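(* Under assumptions (AR-B1)–(AR-B3), for each $\boldsymbol\theta\in\boldsymbol\Theta$ the relative asymptotic equipartition property holds: $P$-almost surely, $$\lim_{n\to\infty}\frac1n\log R_n(\boldsymbol\theta)=-h(\boldsymbol\theta),$$ where $h$ is the Kullback–Leibler divergence rate. Moreover the convergence is uniform over $\boldsymbol\theta$ in any compact subset of $\boldsymbol\Theta$.
   Context: True model $P$: $x_t=\rho_0x_{t-1}+\mathbf z_t'\boldsymbol\beta_0+\epsilon_t$ for $t=1,2,\ldots$, with $x_0=0$, $|\rho_0|<1$, $\epsilon_t$ i.i.d. $N(0,\sigma_0^2)$, where $\mathbf z_t\in\mathbb R^{m+1}$ are given (non-random) covariate vectors. Postulated model: the same equation with unknown $\boldsymbol\theta=(\rho,\boldsymbol\beta,\sigma)\in\boldsymbol\Theta=\mathbb R\times\mathbb R^{m+1}\times(0,\infty)$ in place of $\boldsymbol\theta_0=(\rho_0,\boldsymbol\beta_0,\sigma_0)$, i.e. $f_{\boldsymbol\theta}(\mathbf X_n)=\prod_{t=1}^n(2\pi\sigma^2)^{-1/2}\exp\{-(x_t-\rho x_{t-1}-\mathbf z_t'\boldsymbol\beta)^2/(2\sigma^2)\}$, $p=f_{\boldsymbol\theta_0}$, $R_n(\boldsymbol\theta)=f_{\boldsymbol\theta}(\mathbf X_n)/p(\mathbf X_n)$, and $h(\boldsymbol\theta)=\lim_n n^{-1}E_P[-\log R_n(\boldsymbol\theta)]$. Assumptions: (AR-B1) as $n\to\infty$, $n^{-1}\sum_{t=1}^n\mathbf z_t\to\mathbf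 0$, $n^{-1}\sum_{t=1}^n\mathbf z_{t+k}\mathbf z_t'\to\mathbf 0$ for every $k\ge1$, and $n^{-1}\sum_{t=1}^n\mathbf z_t\mathbf z_t'\to\Sigma_z$; (AR-B2) $\sup_{t\ge1}|\mathbf z_t'\boldsymbol\beta_0|<C$ for some $C>0$; (AR-B3) $\boldsymbol\theta_0$ is an interior point of $\boldsymbol\Theta$. *)

(* Defs.v *)
From HB Require Import structures.
From mathcomp Require Import all_boot all_order all_algebra.
From mathcomp Require Import all_classical all_reals all_analysis.
Set Implicit Arguments. Unset Strict Implicit. Unset Printing Implicit Defensive.
Import Order.TTheory GRing.Theory Num.Theory.
Import numFieldNormedType.Exports.
Local Open Scope classical_set_scope.
Local Open Scope ring_scope.

Section ARmodel.
Context {R : realType} {m : nat}.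

Definition dotc (z b : 'cV[R]_m.+1) : R := \sum_(i < m.+1) z i 0 * b i 0.

Definition param := (R * 'cV[R]_m.+1 * R)%type.
Definition p_rho (th : param) : R := th.1.1.
Definition p_beta (th : param) : 'cV[R]_m.+1 := th.1.2.
Definition p_sigma (th : param) : R := th.2.

Definition Theta : set param := [set th | 0 < p_sigma th].

Fixpoint xproc {T : Type} (th0 : param) (z : nat -> 'cV[R]_m.+1)
    (eps : nat -> T -> R) (t : nat) (w : T) : R :=
  match t with
  | 0 => 0
  | t'.+1 => p_rho th0 * xproc th0 z eps t' w + dotc (z t'.+1) (p_beta th0)
             + eps t'.+1 w
  end.

(** postulated joint density f_theta(X_n) evaluated at the data X_n = (x_1..x_n) *)
Definition fdens {T : Type} (th0 : param) (z : nat -> 'cV[R]_m.+1)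
    (eps : nat -> T -> R) (th : param) (n : nat) (w : T) : R :=
  \prod_(1 <= t < n.+1)
     normal_pdf 0 (p_sigma th)
       (xproc th0 z eps t w - p_rho th * xproc th0 z eps t.-1 w
        - dotc (z t) (p_beta th)).

Definition logRn {T : Type} (th0 : param) (z : nat -> 'cV[R]_m.+1)
    (eps : nat -> T -> R) (th : param) (n : nat) (w : T) : R :=
  ln (fdens th0 z eps th n w / fdens th0 z eps th0 n w).

End ARmodel.

Definition indep_pos {d} {T : measurableType d} {R : realType}
    (P : probability T R) (X : nat -> T -> R) : Prop :=
  forall (s : seq nat), uniq s -> all (fun i => (0 < i)%N) s ->
  forall B : nat -> set R, (forall i, measurable (B i)) ->
  P (\big[setI/setT]_(i <- s) (X i @^-1` B i))
  = (\prod_(i <- s) P (X i @^-1` B i))%E.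

(* Main.v *)
Require Import Defs.
From HB Require Import structures.
From mathcomp Require Import all_boot all_order all_algebra.
From mathcomp Require Import all_classical all_reals all_analysis.
From mathcomp Require Import measurable_realfun ring lra zify.
Set Implicit Arguments.
Unset Strict Implicit.
Unset Printing Implicit Defensive.
Import Order.TTheory GRing.Theory Num.Theory.
Import numFieldNormedType.Exports.
Local Open Scope classical_set_scope.
Local Open Scope ring_scope.

(** Write x_t - rho x_(t-1) - z_t' beta = (rho0 - rho) x_(t-1)
    + z_t' (beta0 - beta) + eps_t.  Then n^-1 log R_n(theta) is a quadratic form
    whose coefficients are continuous in theta, evaluated at the empirical Gram
    matrix of the vectors (z_t, x_(t-1), eps_t).  It is enough that the entries of
    this matrix converge almost surely, and their expectations to the same limits;
    uniformity on compact sets is then automatic.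

    The averages of eps_t^2 - E eps_t^2, of eps_t z_(t+k) and of x_(t-1) eps_t
    vanish almost surely because each is an average of an orthogonal sequence
    whose summed variances are O(n).  On a path where they all vanish, the averages
    of x_(t-1) z_t and of x_(t-1)^2 are found by unrolling the recursion, a purely
    deterministic argument, which also applies to the mean of x_t. *)

(** * Cesaro averages and linear recurrences *)

Section cesaro.
Context {R : realType}.
Implicit Types (f g q c u v x b e : nat -> R).

(** (AR-B1) controls the covariates only on average, so the variances of eps_t z_(t+k) are O(n) in
    sum but need not be individually bounded. This is why the strong law assumes O(n) partial sums
    of variances, and why its proof runs along squares with a summation by parts. For x_(t-1) eps_t
    the summed variance is a multiple of the sum of E x_(t-1)^2, so the averages of these
    expectations must be controlled before the almost sure statement: the recursion is unrolled for
    the mean first and for a path afterwards, and the deterministic lemmas take an arbitrary input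
    sequence in order to serve both. Orthogonality always has the same source: the next noise
    factors out of anything measurable with respect to the past. The exceptional null set is that of
    the Gram matrix, hence the same for every theta and every compact set. *)

Definition avg f (n : nat) : R := n%:R^-1 * \sum_(0 <= t < n) f t.

Lemma avgD f g n : avg (fun t => f t + g t) n = avg f n + avg g n.
Proof. by rewrite /avg big_split/= mulrDr. Qed.

Lemma avgZ k f n : avg (fun t => k * f t) n = k * avg f n.
Proof. by rewrite /avg -mulr_sumr mulrCA. Qed.

Lemma avg_sum (I : finType) (F : I -> nat -> R) n :
  avg (fun t => \sum_i F i t) n = \sum_i avg (F i) n.
Proof. by rewrite /avg exchange_big/= mulr_sumr. Qed.

Lemma avg_cst k n : avg (fun=> k) n.+1 = k.
Proof. by rewrite /avg sumr_const_nat subn0 -[k *+ _]mulr_natl mulKf// pnatr_eq0. Qed.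

Lemma cvg_avg_cst (k : R) : avg (fun=> k) @ \oo --> k.
Proof.
by apply: cvg_near_cst; exists 1%N => // -[//|n] _; rewrite /= avg_cst.
Qed.

Lemma sum_avg f n : \sum_(0 <= t < n) f t = n%:R * avg f n.
Proof.
case: n => [|n]; first by rewrite big_nil mul0r.
by rewrite /avg mulVKf// pnatr_eq0.
Qed.

Lemma cvg_invn1 : (n.+1%:R^-1 : R) @[n --> \oo] --> (0 : R).
Proof. exact: (@cvg_harmonic R). Qed.

Lemma avg_last c (L : R) : avg c @ \oo --> L ->
  (n.+1%:R^-1 * c n) @[n --> \oo] --> (0 : R).
Proof.
move=> cL.
have -> : (fun n => n.+1%:R^-1 * c n) =
    (fun n => avg c n.+1 - avg c n + n.+1%:R^-1 * avg c n).
  apply/funext => n; rewrite {1}/avg big_nat_recr//= sum_avg.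
  have : n.+1%:R != 0 :> R by rewrite pnatr_eq0.
  rewrite -natr1 => n0; by field.
have h1 : (fun n => avg c n.+1 - avg c n) @ \oo --> L - L.
  by apply: cvgB => //; rewrite (cvg_shiftS (avg c)).
have h2 : (fun n => n.+1%:R^-1 * avg c n) @ \oo --> 0 * L.
  by apply: cvgM => //; exact: cvg_invn1.
by have := cvgD h1 h2; rewrite subrr mul0r addr0; exact.
Qed.

Lemma contraction_cvg0 (r : R) b e : 0 <= r < 1 -> (forall n, 0 <= b n) ->
  (forall n, b n.+1 <= r * b n + e n) -> e @ \oo --> (0 : R) -> b @ \oo --> (0 : R).
Proof.
move=> /andP[r0 r1] b0 be e0; apply/cvgr0Pnorm_le => eta eta0.
(* With this error level, eta / 2 is the fixed point of b |-> r b + eta / 2 * (1 - r), which gives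
   the bound [bN] by induction. *)
have er0 : 0 < eta / 2 * (1 - r) by rewrite mulr_gt0 ?subr_gt0// divr_gt0.
have [N _ Ne] : \forall n \near \oo, `|e n| <= eta / 2 * (1 - r).
  by move/cvgr0Pnorm_le : e0; apply.
have bN k : b (N + k)%N <= r ^+ k * b N + eta / 2.
  elim: k => [|k IH]; first by rewrite addn0 expr0 mul1r lerDl ltW// divr_gt0.
  rewrite addnS (le_trans (be _))//.
  have := le_trans (ler_norm _) (Ne (N + k)%N (leq_addr _ _)).
  have := ler_wpM2l r0 IH; rewrite exprS; lra.
have rk : (r ^+ k * b N) @[k --> \oo] --> (0 : R).
  rewrite -(mul0r (b N)); apply: cvgM; last exact: cvg_cst.
  by apply: cvg_expr; rewrite ger0_norm.
have [K _ KP] : \forall k \near \oo, `|r ^+ k * b N| <= eta / 2.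
  by move/cvgr0Pnorm_le : rk; apply; rewrite divr_gt0.
exists (N + K)%N => // n /= NKn; rewrite ger0_norm//.
have -> : n = (N + (n - N))%N by lia.
rewrite (le_trans (bN _))// [leRHS](splitr eta) lerD2r.
by rewrite (le_trans (ler_norm _))// KP//=; lia.
Qed.

(** Summing the recursion over t < n gives (1 - r) avg q = avg c - q_n / n. The boundary term
    vanishes because q_n / (n+1) is contracted by |r| up to the error c_n / (n+1), which tends to 0
    by [avg_last]. *)
Lemma avg_linear_recurrence (r L : R) q c : `|r| < 1 -> q 0%N = 0 ->
  (forall t, q t.+1 = r * q t + c t) -> avg c @ \oo --> L ->
  avg q @ \oo --> L / (1 - r).
Proof.
move=> r1 q0 qS cL.
have r1' : 1 - r != 0 by rewrite subr_eq0 gt_eqF// (le_lt_trans (ler_norm _)).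
have qn0 : (n.+1%:R^-1 * `|q n|) @[n --> \oo] --> (0 : R).
  apply: (@contraction_cvg0 `|r| _ (fun n => `|n.+1%:R^-1 * c n|)).
  - by rewrite normr_ge0.
  - by move=> n; rewrite mulr_ge0.
  - move=> n; rewrite qS normrM [`|_.+1%:R^-1|]ger0_norm//.
    rewrite mulrCA -mulrDr.
    apply: (@le_trans _ _ (n.+1%:R^-1 * `|r * q n + c n|)).
      by rewrite ler_wpM2r// lef_pV2 ?posrE// ler_nat.
    by rewrite ler_wpM2l// (le_trans (ler_normD _ _))// normrM.
  - by rewrite -(normr0 R); apply: cvg_norm; exact: avg_last cL.
have {}qn0 : (n%:R^-1 * q n) @[n --> \oo] --> (0 : R).
  (* Replacing (n+2)^-1 by (n+1)^-1 costs at most a factor 2, whence e / 2. *)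
  apply/cvgrPdist_le => e e0; have e20 : 0 < e / 2 by rewrite divr_gt0.
  move/cvgr0Pnorm_le : qn0 => /(_ _ e20)[N _ NP]; exists N.+1 => // -[//|n] /= Nn.
  rewrite sub0r normrN normrM ger0_norm//.
  have := NP n.+1 (ltnW Nn); rewrite /= normrM normr_id ger0_norm// => h.
  have n0 : (0 : R) < n.+1%:R by rewrite ltr0n.
  rewrite ler_pdivrMl//; move: h; rewrite ler_pdivrMl ?ltr0n// => /le_trans; apply.
  rewrite mulrA mulrAC ler_wpM2r ?(ltW e0)// ler_pdivrMr// -natrM ler_nat; lia.
have -> : avg q = (fun n => (avg c n - n%:R^-1 * q n) / (1 - r)).
  apply/funext => n; apply: (mulIf r1'); rewrite divfK//.
  have : \sum_(0 <= t < n) q t.+1 = r * \sum_(0 <= t < n) q t + \sum_(0 <= t < n) c t.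
    by rewrite mulr_sumr -big_split/=; exact: eq_bigr.
  have : \sum_(0 <= t < n) q t.+1 = \sum_(0 <= t < n) q t + q n.
    by rewrite -big_nat_recr// big_nat_recl//= q0 add0r.
  move=> -> h; rewrite /avg -mulrBr -mulrA; congr (_ * _).
  lra.
apply: cvgM; last exact: cvg_cst.
by rewrite -[X in _ --> X]subr0; exact: cvgB.
Qed.


Lemma sum_le_of_cvg_avg f (L : R) : avg f @ \oo --> L ->
  exists M : R, forall n, \sum_(0 <= t < n) f t <= M * n%:R.
Proof.
move=> fL; have /cvg_seq_bounded[M [_ MP]] : cvgn (avg f) by apply/cvg_ex; exists L.
exists (M + 1) => n; rewrite sum_avg mulrC ler_wpM2r//.
by rewrite (le_trans (ler_norm _))// (MP (M + 1))// ltrDl.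
Qed.

(** Convexity of the square with weights r = |rho| and 1 - r gives x_(t+1)^2 <= r x_t^2 + u_t^2 / (1
    - r). The constant X = U / (1 - r)^2 solves X = r X + U / (1 - r), so it survives the summation
    over t. *)
Lemma ar_sum_sq_le (rho U : R) x u : `|rho| < 1 -> x 0%N = 0 ->
  (forall t, x t.+1 = rho * x t + u t) ->
  (forall n, \sum_(0 <= t < n) u t ^+ 2 <= U * n%:R) ->
  forall n, \sum_(0 <= t < n) x t ^+ 2 <= U / (1 - `|rho|) ^+ 2 * n%:R.
Proof.
move=> r1 x0 xS uU; pose r : R := `|rho|; rewrite -/r.
have r0 : 0 <= r := normr_ge0 rho.
have r1' : 0 < 1 - r by rewrite subr_gt0.
have U0 : 0 <= U by have := uU 1%N; rewrite big_nat1 mulr1; apply: le_trans; exact: sqr_ge0.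
have step t : x t.+1 ^+ 2 <= r * x t ^+ 2 + (1 - r)^-1 * u t ^+ 2.
  rewrite xS -subr_ge0.
  (* Writing rho = s r with s^2 = 1 turns the convexity inequality into a rational identity: a
     square plus a multiple of 1 - s^2. *)
  have [s [s2 ->]] : exists s : R, s ^+ 2 = 1 /\ rho = s * r.
    have [h|h] := leP 0 rho.
      by exists 1; rewrite expr1n mul1r /r ger0_norm.
    by exists (-1); rewrite sqrrN expr1n /r ltr0_norm// mulN1r opprK.
  have -> : r * x t ^+ 2 + (1 - r)^-1 * u t ^+ 2 - (s * r * x t + u t) ^+ 2 =
      r / (1 - r) * ((1 - r) * x t - s * u t) ^+ 2
      + (1 - s ^+ 2) * (r / (1 - r) * u t ^+ 2 + r ^+ 2 * x t ^+ 2).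
    by field; rewrite gt_eqF.
  by rewrite s2 subrr mul0r addr0 mulr_ge0 ?sqr_ge0// divr_ge0// ltW.
elim=> [|n IH]; first by rewrite big_nil mulr0.
rewrite big_nat_recl//= x0 expr0n/= add0r.
apply: (@le_trans _ _ (r * (U / (1 - r) ^+ 2 * n%:R) + (1 - r)^-1 * (U * n%:R))).
  apply: (@le_trans _ _ (r * \sum_(0 <= t < n) x t ^+ 2 +
      (1 - r)^-1 * \sum_(0 <= t < n) u t ^+ 2)).
    by rewrite !mulr_sumr -big_split/=; exact: ler_sum.
  by apply: lerD; apply: ler_wpM2l => //; rewrite invr_ge0 ltW.
have -> : r * (U / (1 - r) ^+ 2 * n%:R) + (1 - r)^-1 * (U * n%:R) =
   U / (1 - r) ^+ 2 * n%:R by field; rewrite gt_eqF.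
by apply: ler_wpM2l; [rewrite divr_ge0// sqr_ge0|rewrite ler_nat].
Qed.

(* The lag-k cross sums satisfy s_k(n+1) = rho * s_(k+1)(n) + o(n) and are O(n)
   uniformly in k, so iterating j times bounds them by |rho|^j M n + o(n). *)
Lemma ar_cross_avg (rho U V : R) x u v : `|rho| < 1 -> x 0%N = 0 ->
  (forall t, x t.+1 = rho * x t + u t) ->
  (forall n, \sum_(0 <= t < n) u t ^+ 2 <= U * n%:R) ->
  (forall n, \sum_(0 <= t < n) v t ^+ 2 <= V * n%:R) ->
  (forall k, avg (fun t => u t * v (t + k.+1)%N) @ \oo --> (0 : R)) ->
  avg (fun t => x t * v t) @ \oo --> (0 : R).
Proof.
move=> r1 x0 xS uU vV uv.
have xX := ar_sum_sq_le r1 x0 xS uU.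
set X := U / _ in xX; pose r : R := `|rho|; have {}r1 : r < 1 := r1.
have r0 : 0 <= r := normr_ge0 rho.
have X0 : 0 <= X by have := xX 1%N; rewrite big_nat1 mulr1; apply: le_trans; exact: sqr_ge0.
have V0 : 0 <= V by have := vV 1%N; rewrite big_nat1 mulr1; apply: le_trans; exact: sqr_ge0.
pose M := X + V; have M0 : 0 <= M by rewrite addr_ge0.
have key j : forall k (eta : R), 0 < eta -> exists N, forall n, (N <= n)%N ->
    `|\sum_(0 <= t < n) x t * v (t + k)%N| <= (r ^+ j * M + eta) * n%:R.
  elim: j => [|j IH] k eta eta0.
    (* For n >= N one has V k <= eta n, so eta absorbs the k extra terms that the lag brings into
       the sum of v^2. *)
    have [N NP] : exists N : nat, V * k%:R / eta < N%:R.
      exists (Num.bound (V * k%:R / eta)).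
      by rewrite archi_boundP// divr_ge0 ?mulr_ge0// ltW.
    exists N => n Nn; rewrite expr0 mul1r.
    apply: (@le_trans _ _ (\sum_(0 <= t < n) (x t ^+ 2 + v (t + k)%N ^+ 2))).
      apply: le_trans (ler_norm_sum _ _ _) _; apply: ler_sum => t _.
      rewrite normrM -(real_normK (num_real (x t))) -(real_normK (num_real (v _))).
      move: `|x t| `|v _| (normr_ge0 (x t)) (normr_ge0 (v (t + k)%N)) => a b a0 b0; nra.
    rewrite big_split/= mulrDl mulrDl -addrA lerD// ?xX//.
    have -> : \sum_(0 <= t < n) v (t + k)%N ^+ 2 = \sum_(k <= t < n + k) v t ^+ 2.
      by rewrite -{2}(add0n k) big_addn addnK.
    apply: (@le_trans _ _ (V * (n + k)%:R)).
      apply: le_trans (vV _); rewrite [leRHS](@big_cat_nat _ _ _ k)//= ?leq_addl//.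
      by rewrite lerDr sumr_ge0// => t _; exact: sqr_ge0.
    rewrite natrD mulrDr lerD2l; move: NP; rewrite ltr_pdivrMr// => /ltW/le_trans; apply.
    by rewrite mulrC ler_pM2l// ler_nat.
  have eta20 : 0 < eta / 2 by rewrite divr_gt0.
  have [N1 N1P] := IH k.+1 _ eta20.
  have [N2 _ N2P] : \forall n \near \oo, `|avg (fun t => u t * v (t + k.+1)%N) n| <= eta / 2.
    by move/cvgr0Pnorm_le : (uv k); apply.
  exists (maxn N1 N2).+1 => -[//|n]; rewrite ltnS geq_max => /andP[N1n N2n].
  rewrite big_nat_recl//= x0 mul0r add0r.
  have -> : \sum_(0 <= t < n) x t.+1 * v (t.+1 + k)%N =
     rho * (\sum_(0 <= t < n) x t * v (t + k.+1)%N) +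
     n%:R * avg (fun t => u t * v (t + k.+1)%N) n.
    rewrite -sum_avg mulr_sumr -big_split/=; apply: eq_bigr => t _.
    by rewrite xS addSnnS; ring.
  apply: le_trans (ler_normD _ _) _; rewrite [`|rho * _|]normrM [`|n%:R * _|]normrM -/r [`|n%:R|]ger0_norm//.
  apply: (@le_trans _ _ (r * ((r ^+ j * M + eta / 2) * n%:R) + n%:R * (eta / 2))).
    apply: lerD; apply: ler_wpM2l => //; first exact: N1P.
    exact: N2P.
  rewrite -(natr1 n) exprS.
  have h1 : 0 <= r * (r ^+ j * M) by rewrite !mulr_ge0// exprn_ge0.
  have h2 : r * (eta / 2 * n%:R) <= eta / 2 * n%:R.
    by rewrite ler_piMl ?(ltW r1)// mulr_ge0// ltW.
  have -> : (r * r ^+ j * M + eta) * (n%:R + 1) =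
    r * (r ^+ j * M) * n%:R + eta / 2 * n%:R + eta / 2 * n%:R
    + (r * (r ^+ j * M) + eta) by field.
  have -> : r * ((r ^+ j * M + eta / 2) * n%:R) + n%:R * (eta / 2) =
    r * (r ^+ j * M) * n%:R + r * (eta / 2 * n%:R) + eta / 2 * n%:R by field.
  lra.
apply/cvgr0Pnorm_le => eta eta0; have eta20 : 0 < eta / 2 by rewrite divr_gt0.
have rM : (r ^+ j * M) @[j --> \oo] --> (0 : R).
  rewrite -(mul0r M); apply: cvgM; last exact: cvg_cst.
  by apply: cvg_expr; rewrite ger0_norm.
(* The number of iterations j is fixed first; the threshold N is allowed to depend on it. *)
have [j _ jP] : \forall j \near \oo, `|r ^+ j * M| <= eta / 2.
  by move/cvgr0Pnorm_le : rM; apply.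
have {}jP := jP j (leqnn j).
have [N NP] := key j 0%N _ eta20.
exists N => // n /= Nn; rewrite /avg normrM ger0_norm//.
have [->|n0] := posnP n; first by rewrite invr0 mul0r ltW.
rewrite ler_pdivrMl ?ltr0n// mulrC.
under eq_bigr do rewrite -[X in v X]addn0.
apply: le_trans (NP _ Nn) _; rewrite ler_wpM2r//.
by rewrite [leRHS](splitr eta) lerD2r (le_trans (ler_norm _)).
Qed.

(** * Reduction of averages to the subsequence of squares *)

Lemma sqr_sum_le a m n :
  (\sum_(m <= t < m + n) a t) ^+ 2 <= n%:R * \sum_(m <= t < m + n) a t ^+ 2 :> R.
Proof.
elim: n => [|n IH]; first by rewrite addn0 !big_geq// expr0n/= mul0r.
rewrite addnS !big_nat_recr ?leq_addr//=.
move: IH; set B := \sum_(_ <= _ < _) a _; set Q := \sum_(_ <= _ < _) _ => IH.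
have [n0|n0] := posnP n.
  by rewrite /B /Q n0 addn0 !big_geq// !add0r mul1r.
have {}n0 : (0 : R) < n%:R by rewrite ltr0n.
have h : 2 * (B * a (m + n)%N) <= Q + n%:R * a (m + n)%N ^+ 2.
  rewrite -(ler_pM2l n0).
  have := sqr_ge0 (B - n%:R * a (m + n)%N); nra.
rewrite -natr1; nra.
Qed.

Lemma exists_nat_sqrt n : (0 < n)%N -> exists j, (j.+1 ^ 2 <= n < j.+2 ^ 2)%N.
Proof.
elim: n => // -[_ _|n /(_ isT)[j /andP[j1 j2]] _]; first by exists 0%N.
have [h|h] := leqP (j.+2 ^ 2) n.+2.
  by exists j.+1; rewrite h/=; nia.
by exists j; rewrite h andbT; nia.
Qed.

(** For (j+1)^2 <= n < (j+2)^2 it satisfies (avg a n)^2 <= 2 [square_block a j]. The first term is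
    the sum up to the last square; the second bounds the rest by Cauchy-Schwarz, 2j+3 being the
    length of the block; the denominator is at most n^2. Being built from squares, it has an
    expectation that orthogonality makes computable. *)
Definition square_block a (j : nat) : R :=
  ((\sum_(0 <= t < j.+1 ^ 2) a t) ^+ 2 +
   (2 * j + 3)%:R * \sum_(j.+1 ^ 2 <= t < j.+2 ^ 2) a t ^+ 2) / j.+1%:R ^+ 4.

Lemma avg_cvg0_square_block a : square_block a @ \oo --> (0 : R) ->
  avg a @ \oo --> (0 : R).
Proof.
move=> ga; apply/cvgr0Pnorm_le => e e0.
have e20 : 0 < e ^+ 2 / 2 by rewrite divr_gt0// exprn_gt0.
have [J _ JP] : \forall j \near \oo, `|square_block a j| <= e ^+ 2 / 2.
  by move/cvgr0Pnorm_le : ga; apply.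
exists (J.+2 ^ 2)%N => // n /= Jn.
have /exists_nat_sqrt[j /andP[j1 j2]] : (0 < n)%N by apply: leq_trans Jn.
have Jj : (J <= j)%N by move: (leq_ltn_trans Jn j2); nia.
have {}JP := le_trans (ler_norm _) (JP j Jj).
rewrite -(ler_pXn2r (_ : 0 < 2)%N) ?nnegrE ?(ltW e0)// real_normK ?num_real//.
rewrite /avg exprMn exprVn.
have n0 : (0 : R) < n%:R ^+ 2 by rewrite exprn_gt0// ltr0n; nia.
rewrite ler_pdivrMl//.
have jn : j.+1%:R ^+ 4 <= n%:R ^+ 2 :> R.
  by rewrite -!natrX ler_nat (_ : j.+1 ^ 4 = (j.+1 ^ 2) ^ 2)%N ?leq_exp2r// -expnM.
move: JP; rewrite /square_block ler_pdivrMr ?exprn_gt0// => JP.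
rewrite (@big_cat_nat _ _ _ (j.+1 ^ 2)%N)//=.
have := sqr_sum_le a (j.+1 ^ 2)%N (n - j.+1 ^ 2)%N; rewrite subnKC//.
set A := \sum_(0 <= _ < _) _ in JP *; set B := \sum_(_ <= _ < n) a _.
set Q := \sum_(_ <= _ < n) _ ; set Q' := \sum_(_ <= _ < _) _ in JP *.
move=> BQ.
have Q0 : 0 <= Q by apply: sumr_ge0 => t _; exact: sqr_ge0.
have QQ' : Q <= Q'.
  rewrite /Q' (@big_cat_nat _ _ _ n)//= ?(ltnW j2)// lerDl.
  by apply: sumr_ge0 => t _; exact: sqr_ge0.
have {}BQ : B ^+ 2 <= (2 * j + 3)%:R * Q'.
  apply: (le_trans BQ); apply: ler_pM => //.
  by rewrite ler_nat; nia.
have h1 : (A + B) ^+ 2 <= 2 * (A ^+ 2 + B ^+ 2) by have := sqr_ge0 (A - B); nra.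
apply: (le_trans h1).
have h2 : e ^+ 2 / 2 * j.+1%:R ^+ 4 <= e ^+ 2 / 2 * n%:R ^+ 2 by rewrite ler_pM2l.
lra.
Qed.

End cesaro.

(** * Independence of the past *)

Section independence.
Context d (T : measurableType d) (R : realType) (P : probability T R).

(** Independence identifies the law of (X, Y) with the product of the two laws, by uniqueness on
    rectangles. Tonelli on the product gives integrability, Fubini the factorisation. *)
Lemma integral_indepM (X Y : {mfun T >-> R}) :
  (forall A B, measurable A -> measurable B ->
    P (X @^-1` A `&` Y @^-1` B) = (P (X @^-1` A) * P (Y @^-1` B))%E) ->
  P.-integrable setT (EFin \o X) -> P.-integrable setT (EFin \o Y) ->
  P.-integrable setT (EFin \o (fun w => X w * Y w)) /\
  \int[P]_w (X w * Y w) = \int[P]_w X w * \int[P]_w Y w.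
Proof.
move=> XY iX iY.
have mX : measurable_fun setT X by [].
have mY : measurable_fun setT Y by [].
have mZ : measurable_fun setT (fun w => (X w, Y w)) by exact: measurable_fun_pair.
pose Z : {mfun T >-> (R * R)%type} :=
  HB.pack (fun w => (X w, Y w)) (isMeasurableFun.Build _ _ _ _ (fun w => (X w, Y w)) mZ).
pose mu : probability _ R := distribution P X.
pose nu : probability _ R := distribution P Y.
pose j : probability _ R := distribution P Z.
have jE (D : set (R * R)) : measurable D -> (mu \x nu)%E D = j D.
  apply: product_measure_unique => A B mA mB.
  by rewrite -[LHS]/(P (X @^-1` A `&` Y @^-1` B)) XY.
pose f (z : R * R) : \bar R := (z.1 * z.2)%:E.
have mf : measurable_fun setT f by apply/measurable_EFinP; exact: measurable_funM.
have mabs : measurable_fun setT (fun x : R => `|x|%:E) by apply/measurable_EFinP; exact: normr_measurable.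
have iabs (V : {mfun T >-> R}) : P.-integrable setT (EFin \o V) ->
    (\int[distribution P V]_x `|x|%:E < +oo)%E.
  move=> /integrableP[_ Voo]; rewrite ge0_integral_distribution//.
have iprod : (mu \x nu)%E.-integrable setT f.
  apply/integrable12ltyP => //.
  under eq_integral.
    move=> x _.
    under eq_integral do rewrite /f/= normrM EFinM.
    rewrite ge0_integralZl//=.
    over.
  rewrite ge0_integralZr//=; last by apply: integral_ge0 => y _.
  by rewrite lte_mul_pinfty ?iabs//; [exact: integral_ge0|rewrite ge0_fin_numE ?iabs//; exact: integral_ge0].
have ij : P.-integrable setT (f \o Z).
  apply/integrableP; split; first exact: measurableT_comp.
  rewrite -[X in (X < _)%E](@ge0_integral_distribution _ _ _ _ _ P Z (fun z => `|f z|%E))//.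
    move/integrableP : iprod => [_]; congr (_ < _)%E.
    by apply: eq_measure_integral => D mD _; exact: jE.
  exact: measurableT_comp.
split => //.
rewrite /Rintegral -fineM ?integrable_fin_num//; congr fine.
transitivity (\int[P]_w (f \o Z) w)%E; first by [].
rewrite -(integral_distribution (X := Z))//.
rewrite -(@eq_measure_integral _ _ _ _ j (mu \x nu)%E); last by move=> D mD _; exact: jE.
rewrite -integral12_prod_meas1//.
have iY' : nu.-integrable setT EFin.
  exact: (@integrable_pushforward _ _ _ _ _ Y mY P setT EFin).
have iX' : mu.-integrable setT EFin.
  exact: (@integrable_pushforward _ _ _ _ _ X mX P setT EFin).
transitivity (\int[mu]_x (x%:E * \int[P]_w (Y w)%:E))%E.
  apply: eq_integral => x _; rewrite /fubini_F /f.
  rewrite -[RHS]/(_ * \int[P]_w (EFin \o Y) w)%E.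
  by rewrite -(integral_distribution (X := Y))// -integralZl//.
rewrite -(fineK (integrable_fin_num _ iY))// integralZr//.
by rewrite (integral_distribution (X := X)).
Qed.

End independence.

(** * The filtration of the noise *)

Section past.
Context d (T : measurableType d) (R : realType) (P : probability T R).
Variable e : nat -> {RV P >-> R}.

(** Only the pi-system of cylinders over e_1, ..., e_n, the events on which [indep_pos] gives the
    product formula directly; [<<s past n>>] is the sigma-algebra of the past. *)
Definition past n : set (set T) :=
  [set S | exists2 B : nat -> set R, (forall i, measurable (B i)) &
     S = \big[setI/setT]_(i <- iota 1 n) (e i @^-1` B i)].

Definition past_measurable n (F : T -> R) :=
  @measurable_fun _ _ (g_sigma_algebraType (past n)) R setT F.

Lemma past_sub_measurable n : past n `<=` measurable.
Proof.
move=> _ [B mB ->]; elim/big_ind : _ => //; first exact: measurableI.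
by move=> i _; rewrite -[X in measurable X]setTI; exact: measurable_funP.
Qed.

Lemma past_setI_closed n : setI_closed (past n).
Proof.
move=> _ _ [A mA ->] [B mB ->]; exists (fun i => A i `&` B i).
  by move=> i; exact: measurableI.
by rewrite -big_split/=; apply: eq_bigr => i _; rewrite preimage_setI.
Qed.

Lemma past_setT n : past n setT.
Proof. by exists (fun=> setT) => //; rewrite big1. Qed.

Lemma past_measurable_noise n i : (0 < i <= n)%N -> past_measurable n (e i).
Proof.
move=> i0n _ A mA; rewrite setTI; apply: sub_sigma_algebra.
exists (fun j => if j == i then A else setT); first by move=> j; case: ifP.
have iin : i \in iota 1 n by rewrite mem_iota add1n ltnS.
rewrite (big_rem i)//= eqxx big1_seq ?setIT// => j /andP[_].
rewrite mem_rem_uniq ?iota_uniq// inE => /andP[/negbTE -> _].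
by rewrite preimage_setT.
Qed.

Lemma past_measurable_measurable n F : past_measurable n F -> measurable_fun setT F.
Proof.
move=> mF _ A mA; have := mF measurableT A mA.
exact: (smallest_sub (@sigma_algebra_measurable _ T) (@past_sub_measurable n)).
Qed.

Lemma past_measurable_cst n k : past_measurable n (fun=> k).
Proof. exact: measurable_cst. Qed.

Lemma past_measurableD n F G : past_measurable n F -> past_measurable n G ->
  past_measurable n (fun w => F w + G w).
Proof. exact: measurable_funD. Qed.

Lemma past_measurableM n F G : past_measurable n F -> past_measurable n G ->
  past_measurable n (fun w => F w * G w).
Proof. exact: measurable_funM. Qed.

Hypothesis indep_e : indep_pos P (fun t => (e t : T -> R)).

(** With B fixed, both sides are finite measures in S. They agree on the pi-system [past n], hence
    on the sigma-algebra it generates. *)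
Lemma past_indep n (S : set T) (B : set R) : <<s past n>> S -> measurable B ->
  P (S `&` e n.+1 @^-1` B) = (P S * P (e n.+1 @^-1` B))%E.
Proof.
move=> nS mB.
have mE : measurable (e n.+1 @^-1` B) by rewrite -[X in measurable X]setTI; exact: measurable_funP.
have Pfin : P (e n.+1 @^-1` B) \is a fin_num by exact: fin_num_measure.
have r0 : 0 <= fine (P (e n.+1 @^-1` B)) by exact: fine_ge0.
have msE S' : mscale (NngNum r0) P S' = (P (e n.+1 @^-1` B) * P S')%E.
  by rewrite -[in RHS](fineK Pfin).
rewrite -[LHS]/(mrestr P mE S) -(fineK Pfin) muleC.
rewrite -[RHS]/(mscale (NngNum r0) P S).
apply: (@g_sigma_algebra_measure_unique _ _ _ (past n) _ (fun=> setT)) nS.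
- exact: past_sub_measurable.
- by move=> _; exact: past_setT.
- by rewrite bigcup_const.
- exact: past_setI_closed.
- move=> _ [A mA ->]; apply: (etrans _ (esym (msE _))); rewrite -[LHS]/(P (_ `&` _)).
  (* Putting B at index n+1 makes the joint event one cylinder over 1, ..., n+1, to which
     independence applies at once. *)
  pose C i := if i == n.+1 then B else A i.
  have mC i : measurable (C i) by rewrite /C; case: ifP.
  have CA (F : nat -> set R -> set T) : \big[setI/setT]_(i <- iota 1 n) F i (A i) =
      \big[setI/setT]_(i <- iota 1 n) F i (C i).
    apply: eq_big_seq => i; rewrite mem_iota add1n ltnS => /andP[_ ni].
    by rewrite /C ltn_eqF.
  have pos_iota k : all (fun i => 0 < i)%N (iota 1 k).
    by apply/allP => i; rewrite mem_iota => /andP[].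
  have := indep_e (iota_uniq 1 n.+1) (pos_iota _) mC.
  rewrite (_ : iota 1 n.+1 = iota 1 n ++ [:: n.+1]); last by rewrite -(addn1 n) iotaD/= add1n addn1.
  rewrite !big_cat/= !big_seq1 -(CA (fun i => preimage (e i))).
  rewrite (_ : C n.+1 = B) ?{1}/C ?eqxx// => ->; rewrite muleC; congr (_ * _)%E.
  rewrite (CA (fun i => preimage (e i))).
  by rewrite (indep_e (iota_uniq 1 n) (pos_iota _) mC).
- by move=> _; rewrite -[X in (X < _)%E]/(P (setT `&` _)) setTI ltey_eq Pfin.
Qed.

(** Plays the part of conditioning on the past. It is used with g the identity, the square and the
    centred square. *)
Lemma integral_pastM n (F : T -> R) (g : R -> R) :
  past_measurable n F -> measurable_fun setT g ->
  P.-integrable setT (EFin \o F) -> P.-integrable setT (EFin \o (g \o e n.+1)) ->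
  P.-integrable setT (EFin \o (fun w => F w * g (e n.+1 w))) /\
  \int[P]_w (F w * g (e n.+1 w)) = \int[P]_w F w * \int[P]_w g (e n.+1 w).
Proof.
move=> pF mg iF ig.
have mF := past_measurable_measurable pF.
have mge : measurable_fun setT (g \o e n.+1) by exact: measurableT_comp.
pose X : {mfun T >-> R} := HB.pack F (isMeasurableFun.Build _ _ _ _ F mF).
pose Y : {mfun T >-> R} := HB.pack (g \o e n.+1) (isMeasurableFun.Build _ _ _ _ (g \o e n.+1) mge).
apply: (@integral_indepM _ _ _ P X Y) => // A B mA mB.
rewrite [X in P (_ `&` X)]comp_preimage [X in (_ * P X)%E]comp_preimage.
apply: past_indep; last by rewrite -[X in measurable X]setTI; exact: mg.
by have := pF measurableT A mA; rewrite setTI.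
Qed.

End past.

(** * Moments of the normal distribution *)

Section normal_moments.
Context {R : realType}.
Notation mu := (@lebesgue_measure R).

Lemma ge0_integral_normal_prob (s : R) (f : R -> \bar R) :
  measurable_fun setT f -> (forall x, 0 <= f x)%E ->
  (\int[normal_prob 0 s]_x f x = \int[mu]_x (f x * (normal_pdf 0 s x)%:E))%E.
Proof.
move=> mf f0.
rewrite -(Radon_Nikodym_SigmaFinite.change_of_variables (normal_prob_dominates 0 s))//.
have iRN := Radon_Nikodym_SigmaFinite.f_integrable (normal_prob_dominates 0 s).
have mpdf : measurable_fun setT (fun x => (normal_pdf 0 s x)%:E).
  by apply/measurable_EFinP; exact: measurable_normal_pdf.
apply: ae_eq_integral => //.
- by apply: emeasurable_funM => //; exact: measurable_int iRN.
- exact: emeasurable_funM.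
- apply: ae_eqe_mul2l; apply: integral_ae_eq => // E _ mE.
  by rewrite -(Radon_Nikodym_SigmaFinite.f_integral (normal_prob_dominates 0 s)).
Qed.

(** The factor x^4 is paid for by doubling the deviation. With y = x^2 / (8 s^2) the two
    exponentials are exp(-4y) and exp(-y), and x^4 = 64 s^4 y^2, so the claim is y^2 <= exp(3y). *)
Lemma expr4_normal_fun_le (s x : R) : s != 0 ->
  x ^+ 4 * normal_fun 0 s x <= 64 * s ^+ 4 * normal_fun 0 (2 * s) x.
Proof.
move=> s0; rewrite /normal_fun subr0.
pose y := x ^+ 2 / (8 * s ^+ 2).
have y0 : 0 <= y .
  by apply: divr_ge0; [exact: sqr_ge0|rewrite mulr_ge0 ?sqr_ge0 ?ler0n].
have -> : - x ^+ 2 / (s ^+ 2 *+ 2) = (- y) + - (3 * y).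
  by rewrite /y -mulr_natl; field.
have -> : - x ^+ 2 / ((2 * s) ^+ 2 *+ 2) = - y.
  by rewrite /y -mulr_natl; field.
have -> : x ^+ 4 = 64 * s ^+ 4 * y ^+ 2 by rewrite /y; field.
rewrite expRD [expR (- y) * _]mulrC mulrA ler_wpM2r ?expR_ge0//.
rewrite -mulrA ler_piMr//.
  by rewrite mulr_ge0 ?exprn_even_ge0.
rewrite expRN ler_pdivrMr ?expR_gt0// mul1r.
have h1 : y <= expR y by apply: le_trans (expR_ge1Dx y); lra.
have h2 : 1 <= expR y by rewrite -expR0 ler_expR.
rewrite (_ : 3 * y = y + y + y); last by ring.
rewrite !expRD; move: (expR y) h1 h2 => E h1 h2.
have h3 : y ^+ 2 <= E ^+ 2 by rewrite ler_pXn2r// nnegrE; lra.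
nra.
Qed.

(** The fourth moment is what makes eps_t^2 square integrable, so that the orthogonal strong law
    applies to it. *)
Lemma normal_prob_expr4_lty (s : R) : s != 0 ->
  (\int[normal_prob 0 s]_x (x ^+ 4)%:E < +oo)%E.
Proof.
move=> s0; have s20 : 2 * s != 0 by rewrite mulf_neq0.
have m4 : measurable_fun setT (fun x : R => (x ^+ 4)%:E).
  by apply/measurable_EFinP; exact: measurable_funX.
rewrite ge0_integral_normal_prob//; last by move=> x; rewrite lee_fin exprn_even_ge0.
pose c := normal_peak s * (64 * s ^+ 4) / normal_peak (2 * s).
apply: (@le_lt_trans _ _ (\int[mu]_x (c%:E * (normal_pdf 0 (2 * s) x)%:E))%E).
  apply: ge0_le_integral => //=.
  - by move=> x _; rewrite -EFinM lee_fin mulr_ge0 ?exprn_even_ge0 ?normal_pdf_ge0.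
  - apply: emeasurable_funM => //; apply/measurable_EFinP; exact: measurable_normal_pdf.
  - apply: emeasurable_funM => //; apply/measurable_EFinP; exact: measurable_normal_pdf.
  - move=> x _; rewrite -!EFinM lee_fin !normal_pdfE// mulrCA /c.
    rewrite [leRHS](_ : _ = normal_peak s * (64 * s ^+ 4 * normal_fun 0 (2 * s) x)).
      by rewrite ler_wpM2l ?normal_peak_ge0// expr4_normal_fun_le.
    by field; rewrite gt_eqF// normal_peak_gt0.
rewrite integralZl//; last exact: integrable_normal_pdf.
by rewrite integral_normal_pdf mule1 ltry.
Qed.

Lemma normal_probN (s : R) (A : set R) : s != 0 -> measurable A ->
  normal_prob 0 s (-%R @^-1` A) = normal_prob 0 s A.
Proof.
move=> s0 mA; rewrite /normal_prob.
have mpdf : measurable_fun setT (fun x => (normal_pdf 0 s x)%:E).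
  by apply/measurable_EFinP; exact: measurable_normal_pdf.
transitivity (\int[mu]_(x in -%R @^-1` A) ((fun x => (normal_pdf 0 s x)%:E) \o -%R) x)%E.
  by apply: eq_integral => x _; rewrite /= !normal_pdfE// /normal_fun !subr0 sqrrN.
rewrite -(@ge0_integral_pushforward _ _ _ _ _ (-%R : measurableTypeR R -> measurableTypeR R))//.
- by apply: eq_measure_integral => B mB _; exact: lebesgue_measureN.
- exact: measurable_funTS.
- by move=> x _; rewrite lee_fin normal_pdf_ge0.
Qed.

End normal_moments.

Section normal_variable.
Context d (T : measurableType d) (R : realType) (P : probability T R).
Variables (X : {RV P >-> R}) (s : R).
Hypothesis s0 : s != 0.
Hypothesis normalX : forall A, measurable A -> P (X @^-1` A) = normal_prob 0 s A.

Let measurable_X : measurable_fun setT (X : T -> measurableTypeR R).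
Proof. exact: (measurable_funP X). Qed.

Lemma normal_integrable_expr4 : P.-integrable setT (EFin \o (fun w => X w ^+ 4)).
Proof.
have m4 : measurable_fun setT (fun x : measurableTypeR R => (x ^+ 4)%:E).
  by apply/measurable_EFinP; exact: measurable_funX.
apply/integrableP; split.
  by apply/measurable_EFinP; exact: measurable_funX.
under eq_integral do rewrite /= ger0_norm ?exprn_even_ge0//.
rewrite -[X in (X < _)%E](@ge0_integral_pushforward _ _ _ _ _ _ measurable_X P setT
  (fun x => (x ^+ 4)%:E))//; last by move=> x _; rewrite lee_fin exprn_even_ge0.
apply: le_lt_trans (normal_prob_expr4_lty s0).
rewrite le_eqVlt; apply/orP; left; apply/eqP.
by apply: eq_measure_integral => A mA _; exact: normalX.
Qed.

(** By symmetry X and -X have the same law, so the mean equals its own opposite. *)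
Lemma normal_integral0 : P.-integrable setT (EFin \o X) -> \int[P]_w X w = 0.
Proof.
move=> iX; suff : \int[P]_w X w = - \int[P]_w X w by lra.
have mN : measurable_fun setT ((fun w => - X w) : T -> measurableTypeR R).
  have mNX : measurable_fun setT (fun w => - X w) by exact: measurableT_comp.
  exact: mNX.
have iN : P.-integrable setT (EFin \o (fun w => - X w)) by exact: (integrableN iX).
rewrite -[RHS]mulN1r -RintegralZl//; congr fine.
have mE : measurable_fun setT (EFin : measurableTypeR R -> \bar R) by exact/measurable_EFinP.
rewrite -[LHS](@integral_pushforward _ _ _ _ _ _ measurable_X P setT EFin)//.
transitivity (\int[P]_w (EFin \o (fun w => - X w)%R) w)%E; last first.
  by apply: eq_integral => w _ /=; rewrite mulN1r.
rewrite -[RHS](@integral_pushforward _ _ _ _ _ _ mN P setT EFin)//.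
apply: eq_measure_integral => A mA _.
rewrite -[LHS]/(P (X @^-1` A)) -[RHS]/(P (X @^-1` (-%R @^-1` A))).
have mA' : measurable (-%R @^-1` A : set R).
  by rewrite -[X in measurable X]setTI; exact: (@oppr_measurable R).
by rewrite (normalX mA') normal_probN//; exact: normalX.
Qed.

End normal_variable.

(** * A strong law for orthogonal sequences *)

Section square_integrable.
Context d (T : measurableType d) (R : realType) (P : probability T R).
Implicit Types X Y : T -> R.

Definition L2 X := measurable_fun setT X /\ P.-integrable setT (EFin \o (fun w => X w ^+ 2)).

Lemma integrableD_fun X Y : P.-integrable setT (EFin \o X) ->
  P.-integrable setT (EFin \o Y) -> P.-integrable setT (EFin \o (fun w => X w + Y w)).
Proof. by move=> iX iY; exact: (integrableD _ iX iY). Qed.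

Lemma integrableZ_fun k X : P.-integrable setT (EFin \o X) ->
  P.-integrable setT (EFin \o (fun w => k * X w)).
Proof. by move=> iX; exact: (integrableZl _ k iX). Qed.

Lemma integrable_cst_fun k : P.-integrable setT (EFin \o (fun _ : T => k)).
Proof. exact: finite_measure_integrable_cst. Qed.

Lemma integrable_sum_fun (I : Type) (r : seq I) (F : I -> T -> R) :
  (forall i, P.-integrable setT (EFin \o F i)) ->
  P.-integrable setT (EFin \o (fun w => \sum_(i <- r) F i w)).
Proof.
move=> iF; elim: r => [|i r IH].
  under eq_fun do rewrite big_nil; exact: integrable_cst_fun.
under eq_fun do rewrite big_cons; exact: integrableD_fun.
Qed.

Lemma Rintegral_sum_fun (I : Type) (r : seq I) (F : I -> T -> R) :
  (forall i, P.-integrable setT (EFin \o F i)) ->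
  \int[P]_w (\sum_(i <- r) F i w) = \sum_(i <- r) \int[P]_w F i w.
Proof.
move=> iF; elim: r => [|i r IH].
  rewrite big_nil; under eq_Rintegral do rewrite big_nil.
  by rewrite Rintegral_cst// mul0r.
rewrite big_cons -IH -RintegralD//; last exact: integrable_sum_fun.
by under eq_Rintegral do rewrite big_cons.
Qed.

Lemma L2M X Y : L2 X -> L2 Y -> P.-integrable setT (EFin \o (fun w => X w * Y w)).
Proof.
move=> [mX iX] [mY iY].
apply: (le_integrable _ _ _ (integrableD_fun iX iY)) => //.
  by apply/measurable_EFinP; exact: measurable_funM.
move=> w _; rewrite lee_fin normrM [leRHS]ger0_norm ?addr_ge0 ?sqr_ge0//.
rewrite -(real_normK (num_real (X w))) -(real_normK (num_real (Y w))).
move: `|X w| `|Y w| (normr_ge0 (X w)) (normr_ge0 (Y w)) => a b a0 b0; nra.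
Qed.

Lemma L2_cst k : L2 (fun=> k).
Proof. by split => //; exact: integrable_cst_fun. Qed.

Lemma L2_integrable X : L2 X -> P.-integrable setT (EFin \o X).
Proof.
move=> LX; have := L2M LX (L2_cst 1).
by under [X in EFin \o X]eq_fun do rewrite mulr1.
Qed.

Lemma L2D X Y : L2 X -> L2 Y -> L2 (fun w => X w + Y w).
Proof.
move=> LX LY; split.
  by case: LX => mX _; case: LY => mY _; exact: measurable_funD.
rewrite (_ : (fun w => _) = fun w => X w ^+ 2 + (2 * (X w * Y w) + Y w ^+ 2)).
  apply: integrableD_fun; first by case: LX.
  by apply: integrableD_fun; [exact/integrableZ_fun/L2M|case: LY].
by apply/funext => w; ring.
Qed.

Lemma L2Z k X : L2 X -> L2 (fun w => k * X w).
Proof.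
move=> [mX iX]; split; first exact: measurable_funM.
under [X in EFin \o X]eq_fun do rewrite exprMn.
exact: integrableZ_fun.
Qed.

Lemma L2_sum (F : nat -> T -> R) n : (forall t, L2 (F t)) ->
  L2 (fun w => \sum_(0 <= t < n) F t w).
Proof.
move=> LF; elim: n => [|n IH].
  under eq_fun do rewrite big_nil; exact: L2_cst.
under eq_fun do rewrite big_nat_recr//=; exact: L2D.
Qed.

End square_integrable.

Section orthogonal_slln.
Context d (T : measurableType d) (R : realType) (P : probability T R).
Variables (xi : nat -> T -> R) (C : R).
Hypothesis L2xi : forall t, L2 P (xi t).
Hypothesis orth : forall s t, (s < t)%N -> \int[P]_w (xi s w * xi t w) = 0.
Hypothesis varC : forall n,
  \sum_(0 <= t < n) \int[P]_w (xi t w ^+ 2) <= C * n%:R.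

Let V n := \sum_(0 <= t < n) \int[P]_w (xi t w ^+ 2).

Let i2 t : P.-integrable setT (EFin \o (fun w => xi t w ^+ 2)).
Proof. by case: (L2xi t). Qed.

Let sum_sq n : \int[P]_w ((\sum_(0 <= t < n) xi t w) ^+ 2) = V n.
Proof.
rewrite /V; elim: n => [|n IH].
  under eq_Rintegral do rewrite big_nil expr0n/=.
  by rewrite Rintegral_cst// mul0r big_nil.
rewrite big_nat_recr//= -IH.
have LS := L2_sum n L2xi.
under eq_Rintegral.
  move=> w _; rewrite big_nat_recr//= sqrrD -mulr_natl -addrA.
  rewrite mulr_suml.
  over.
rewrite RintegralD//=; last 2 first.
- by case: LS.
- apply: integrableD_fun => //; apply: integrableZ_fun.
  by apply: integrable_sum_fun => t; exact: L2M.
rewrite RintegralD//=; last first.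
  by apply: integrableZ_fun; apply: integrable_sum_fun => t; exact: L2M.
rewrite RintegralZl//; last by apply: integrable_sum_fun => t; exact: L2M.
rewrite Rintegral_sum_fun; last by move=> t; exact: L2M.
rewrite big_nat big1 ?mulr0 ?add0r// => t /andP[_ tn].
exact: orth.
Qed.

Let g j w := square_block (fun t => xi t w) j.

Let ig j : P.-integrable setT (EFin \o g j).
Proof.
rewrite /g /square_block; under [X in EFin \o X]eq_fun do rewrite mulrC.
apply/integrableZ_fun/integrableD_fun; first by case: (L2_sum (j.+1 ^ 2) L2xi).
apply: integrableZ_fun; exact: integrable_sum_fun.
Qed.

Let gE j : \int[P]_w g j w =
  (V (j.+1 ^ 2) + (2 * j + 3)%:R * (V (j.+2 ^ 2) - V (j.+1 ^ 2))) / j.+1%:R ^+ 4.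
Proof.
have iS : P.-integrable setT (EFin \o (fun w => (\sum_(0 <= t < j.+1 ^ 2) xi t w) ^+ 2)).
  by case: (L2_sum (j.+1 ^ 2) L2xi).
have iB : P.-integrable setT (EFin \o (fun w => \sum_(j.+1 ^ 2 <= t < j.+2 ^ 2) xi t w ^+ 2)).
  exact: integrable_sum_fun.
rewrite /g /square_block RintegralZr//; last exact/integrableD_fun/integrableZ_fun.
rewrite RintegralD//; last exact: integrableZ_fun.
rewrite RintegralZl// sum_sq Rintegral_sum_fun//; congr ((_ + _ * _) / _).
by rewrite /V [X in _ = X - _](@big_cat_nat _ _ _ (j.+1 ^ 2)%N)//= ?leq_exp2r// addrAC subrr add0r.
Qed.

Let V_ge0 n : 0 <= V n.
Proof. by apply: sumr_ge0 => t _; apply: Rintegral_ge0 => w _; exact: sqr_ge0. Qed.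

Let V_nd n m : (n <= m)%N -> V n <= V m.
Proof.
move=> nm; rewrite /V [leRHS](@big_cat_nat _ _ _ n)//= lerDl.
by apply: sumr_ge0 => t _; apply: Rintegral_ge0 => w _; exact: sqr_ge0.
Qed.

(** Only the partial sums V are O(n), so the increments of V over blocks are summed by parts; the
    first term on the right is the boundary term. With k = n+1, 2k+1 <= 3k gives the factor 3, and
    3k^2+3k+1 <= 7k^2 gives 21 C / (k (k+1)). Adding C / k^2 <= 2 C / (k (k+1)) makes 23, and 1 / (k
    (k+1)) telescopes. *)
Let sum_g_le n : \sum_(0 <= j < n) \int[P]_w g j w <=
  3 * V (n.+1 ^ 2) / n.+1%:R ^+ 3 + 23 * C * (1 - n.+1%:R^-1).
Proof.
have C0 : 0 <= C by have := varC 1%N; rewrite mulr1; apply: le_trans; exact: V_ge0.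
elim: n => [|n IH].
  by rewrite big_nil invr1 subrr mulr0 addr0 !mulr_ge0.
rewrite big_nat_recr//= (le_trans (lerD IH (lexx _)))// gE.
have VW : V (n.+1 ^ 2) <= V (n.+2 ^ 2) by apply: V_nd; rewrite leq_exp2r.
have W0 : 0 <= V (n.+1 ^ 2) by exact: V_ge0.
have WC : V (n.+1 ^ 2) <= C * n.+1%:R ^+ 2 by rewrite -natrX; exact: varC.
have WC' : V (n.+2 ^ 2) <= C * (n.+1%:R + 1) ^+ 2 by rewrite natr1 -natrX; exact: varC.
rewrite (_ : (2 * n + 3)%:R = 2 * n.+1%:R + 1 :> R); last first.
  by rewrite -natrM natr1; congr (_%:R); lia.
rewrite -(natr1 n.+1).
move: (V (n.+1 ^ 2)) (V (n.+2 ^ 2)) VW W0 WC WC' => A B AB A0 AC BC.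
have : (1 : R) <= n.+1%:R by rewrite ler1n.
move: n.+1%:R AC BC => k AC BC k1; have k0 : 0 < k by lra.
have k10 : 0 < k + 1 by lra.
have h1 : (A + (2 * k + 1) * (B - A)) / k ^+ 4 <=
    C / k ^+ 2 + 3 * B / k ^+ 3 - 3 * A / k ^+ 3.
  rewrite ler_pdivrMr ?exprn_gt0//.
  have -> : (C / k ^+ 2 + 3 * B / k ^+ 3 - 3 * A / k ^+ 3) * k ^+ 4 =
     C * k ^+ 2 + 3 * k * (B - A) by field; lra.
  have : 0 <= (k - 1) * (B - A) by rewrite mulr_ge0// subr_ge0.
  lra.
have h2 : 3 * B / k ^+ 3 - 3 * B / (k + 1) ^+ 3 <= 21 * C / (k * (k + 1)).
  have -> : 3 * B / k ^+ 3 - 3 * B / (k + 1) ^+ 3 =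
    3 * B * (3 * k ^+ 2 + 3 * k + 1) / (k ^+ 3 * (k + 1) ^+ 3) by field; lra.
  rewrite ler_pdivrMr ?mulr_gt0 ?exprn_gt0//.
  have -> : 21 * C / (k * (k + 1)) * (k ^+ 3 * (k + 1) ^+ 3) =
     3 * (C * (k + 1) ^+ 2) * (7 * k ^+ 2) by field; lra.
  apply: ler_pM.
  - by lra.
  - by nra.
  - by lra.
  - by nra.
have h3 : C / k ^+ 2 <= 2 * C / (k * (k + 1)).
  rewrite ler_pdivrMr ?exprn_gt0//.
  have -> : 2 * C / (k * (k + 1)) * k ^+ 2 = C * (2 * k / (k + 1)) by field; lra.
  by rewrite ler_peMr// ler_pdivlMr//; lra.
have h4 : 23 * C * (1 - (k + 1)^-1) = 23 * C * (1 - k^-1) + 21 * C / (k * (k + 1)) + 2 * C / (k * (k + 1)).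
  by field; lra.
lra.
Qed.

(* Along n = j^2 the normalised sums are square summable in j, and by
   Cauchy-Schwarz so are the oscillations on [j^2, (j+1)^2]. *)
Lemma orthogonal_slln :
  {ae P, forall w, avg (fun t => xi t w) @ \oo --> (0 : R)}.
Proof.
have C0 : 0 <= C by have := varC 1%N; rewrite mulr1; apply: le_trans; exact: V_ge0.
have g0 j w : 0 <= g j w.
  rewrite divr_ge0// addr_ge0 ?sqr_ge0// mulr_ge0// sumr_ge0// => t _.
  exact: sqr_ge0.
have mg j : measurable_fun setT (fun w => (g j w)%:E) by exact: measurable_int (ig j).
(* By Tonelli the series of blocks has expectation at most 3 C + 23 C. It is thus almost surely
   finite, and its terms tend to 0. *)
have Soo : (\int[P]_w (\sum_(0 <= j <oo) (g j w)%:E) < +oo)%E.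
  rewrite integral_nneseries//; last by move=> j w _; rewrite lee_fin.
  apply: (@le_lt_trans _ _ (26 * C)%:E); last exact: ltry.
  apply: lime_le.
    by apply: is_cvg_nneseries => j _ _; apply: integral_ge0 => w _; rewrite lee_fin.
  apply: nearW => n.
  rewrite (eq_bigr (fun j => (\int[P]_w g j w)%:E)); last first.
    by move=> j _; rewrite fineK//; exact: integrable_fin_num (ig j).
  rewrite sumEFin lee_fin (le_trans (sum_g_le n))//.
  have k1 : (1 : R) <= n.+1%:R by rewrite ler1n.
  have := varC (n.+1 ^ 2); rewrite -/(V _) natrX.
  move: (V _) n.+1%:R k1 => B k k1 BC; have k0 : 0 < k by lra.
  have h1 : 3 * B / k ^+ 3 <= 3 * C.
    rewrite ler_pdivrMr ?exprn_gt0//.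
    have : C * k ^+ 2 <= C * k ^+ 3 by rewrite ler_wpM2l// exprS ler_peMl// sqr_ge0.
    lra.
  have h2 : 0 <= 23 * C * k^-1 by rewrite !mulr_ge0// invr_ge0 ltW.
  lra.
have iS : P.-integrable setT (fun w => \sum_(0 <= j <oo) (g j w)%:E)%E.
  apply/integrableP; split; first by apply: ge0_emeasurable_sum => // j w _ _; rewrite lee_fin.
  rewrite (eq_integral (fun w => \sum_(0 <= j <oo) (g j w)%:E)%E)//.
  by move=> w _; rewrite gee0_abs// nneseries_ge0// => j _ _; rewrite lee_fin.
have := integrable_ae measurableT iS; apply: filterS => w /(_ I) Sfin.
apply: avg_cvg0_square_block; apply: cvg_series_cvg_0.
by apply: nnseries_is_cvg => [j|]; [exact: g0|rewrite ltey_eq Sfin].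
Qed.

End orthogonal_slln.

(** * The autoregression *)

Lemma cvg_avg_mx (R : realType) (m : nat) (z : nat -> 'cV[R]_m.+1) k
    (M : 'M[R]_m.+1) i j :
  (fun n : nat => n%:R^-1 *: \sum_(1 <= t < n.+1) (z (t + k)%N *m (z t)^T))
       @ \oo --> M ->
  avg (fun t => z (t + k).+1 i 0 * z t.+1 j 0) @ \oo --> M i j.
Proof.
move=> zM.
rewrite (_ : avg _ = fun n : nat =>
  (n%:R^-1 *: \sum_(1 <= t < n.+1) (z (t + k)%N *m (z t)^T)) i j).
  exact: (cvg_comp _ _ zM (@coord_continuous _ _ _ i j M)).
apply/funext => n; rewrite mxE summxE big_add1/= /avg; congr (_ * _).
by apply: eq_bigr => t _; rewrite mxE big_ord1 mxE.
Qed.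

Lemma cvg_sum_fin (R : realType) (I : finType) (F : I -> nat -> R) (L : I -> R) :
  (forall i, F i @ \oo --> L i) -> (fun n => \sum_i F i n) @ \oo --> \sum_i L i.
Proof.
move=> FL; rewrite (_ : (fun n => _) = \sum_i F i); last first.
  by apply/funext => n; rewrite fct_sumE.
by apply: (big_ind2 (fun (f : nat -> R) (l : R) => f @ \oo --> l)) => //;
  [exact: cvg_cst|move=> ? ? ? ?; exact: cvgD].
Qed.

(** * Deterministic averages of the drift, the covariates and the recursion *)

Section regression.
Context (R : realType) (m : nat) (z : nat -> 'cV[R]_m.+1) (Sigma : 'M[R]_m.+1).
Hypothesis zz_lag : forall k, (0 < k)%N ->
  (fun n : nat => n%:R^-1 *: \sum_(1 <= t < n.+1) (z (t + k)%N *m (z t)^T))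
       @ \oo --> (0 : 'M[R]_m.+1).
Hypothesis zz : (fun n : nat => n%:R^-1 *: \sum_(1 <= t < n.+1) (z t *m (z t)^T))
    @ \oo --> Sigma.
Variables (b : 'cV[R]_m.+1).

(* Time is shifted by one: index t stands for t + 1 in the model. *)
Definition covariate i t : R := z t.+1 i 0.

Definition drift t : R := dotc (z t.+1) b.

(** The quadratic form b' Sigma b. *)
Definition drift_energy : R := \sum_i \sum_j b i 0 * b j 0 * Sigma i j.

Lemma driftE t : drift t = \sum_i b i 0 * covariate i t.
Proof. by apply: eq_bigr => i _; rewrite mulrC. Qed.

Lemma avg_covariate i j :
  avg (fun t => covariate i t * covariate j t) @ \oo --> Sigma i j.
Proof.
have -> : (fun t => covariate i t * covariate j t) =
    (fun t => z (t + 0).+1 i 0 * z t.+1 j 0) by apply/funext => t; rewrite addn0.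
apply: cvg_avg_mx.
rewrite (_ : (fun n : nat => _) = (fun n : nat => n%:R^-1 *: \sum_(1 <= t < n.+1) (z t *m (z t)^T)))//.
by apply/funext => n; congr (_ *: _); apply: eq_bigr => t _; rewrite addn0.
Qed.

Lemma covariate_sq_bound i :
  exists M : R, forall n, \sum_(0 <= t < n) covariate i t ^+ 2 <= M * n%:R.
Proof.
have [M MP] := sum_le_of_cvg_avg (@avg_covariate i i).
by exists M => n; under eq_bigr do rewrite expr2; exact: MP.
Qed.

Lemma avg_drift_cvg0 u : (forall i, avg (fun t => covariate i t * u t) @ \oo --> (0 : R)) ->
  avg (fun t => drift t * u t) @ \oo --> (0 : R).
Proof.
move=> h.
rewrite (_ : avg _ = fun n => \sum_i b i 0 * avg (fun t => covariate i t * u t) n).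
  have s0 : \sum_(i < m.+1) b i 0 * 0 = 0 :> R by rewrite big1// => i _; rewrite mulr0.
  rewrite -[X in _ --> X]s0.
  apply: (@cvg_sum_fin _ _ (fun i n => b i 0 * avg (fun t => covariate i t * u t) n)
    (fun i => b i 0 * 0)) => i.
  by apply: cvgM => //; exact: cvg_cst.
apply/funext => n; under eq_bigr do rewrite -avgZ; rewrite -avg_sum; congr avg.
by apply/funext => t; rewrite driftE mulr_suml; apply: eq_bigr => i _; rewrite mulrA.
Qed.

Lemma avg_drift_lag i k :
  avg (fun t => drift t * covariate i (t + k.+1)) @ \oo --> (0 : R).
Proof.
apply: (@avg_drift_cvg0 (fun t => covariate i (t + k.+1))) => j.
rewrite (_ : (fun t => _) = (fun t => z (t + k.+1).+1 i 0 * z t.+1 j 0)).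
  by have := @cvg_avg_mx _ _ _ _ _ i j (zz_lag (ltn0Sn k)); rewrite mxE.
by apply/funext => t; rewrite mulrC.
Qed.

Lemma avg_drift_sq : avg (fun t => drift t ^+ 2) @ \oo --> drift_energy.
Proof.
rewrite (_ : avg _ = fun n => \sum_i \sum_j b i 0 * b j 0 *
    avg (fun t => covariate i t * covariate j t) n).
  apply: (@cvg_sum_fin _ _ (fun i n => \sum_j b i 0 * b j 0 *
    avg (fun t => covariate i t * covariate j t) n)
    (fun i => \sum_j b i 0 * b j 0 * Sigma i j)) => i.
  apply: (@cvg_sum_fin _ _ (fun j n => b i 0 * b j 0 *
    avg (fun t => covariate i t * covariate j t) n)
    (fun j => b i 0 * b j 0 * Sigma i j)) => j.
  by apply: cvgM; [exact: cvg_cst|exact: avg_covariate].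
apply/funext => n; under eq_bigr do under eq_bigr do rewrite -avgZ.
under eq_bigr do rewrite -avg_sum; rewrite -avg_sum; congr avg.
apply/funext => t; rewrite expr2 driftE mulr_suml; apply: eq_bigr => i _.
by rewrite mulr_sumr; apply: eq_bigr => j _; ring.
Qed.

Variable rho : R.
Hypothesis rho1 : `|rho| < 1.

(** Used with the drift alone as input, for E x_t, and with drift plus noise, for a sample path. *)
Lemma avg_ar_covariate x u i : x 0%N = 0 -> (forall t, x t.+1 = rho * x t + u t) ->
  (exists U : R, forall n, \sum_(0 <= t < n) u t ^+ 2 <= U * n%:R) ->
  (forall k, avg (fun t => u t * covariate i (t + k.+1)) @ \oo --> (0 : R)) ->
  avg (fun t => x t * covariate i t) @ \oo --> (0 : R).
Proof.
move=> x0 xS [U uU] uz; have [V vV] := covariate_sq_bound i.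
exact: (ar_cross_avg rho1 x0 xS uU vV).
Qed.

(** Squaring the recursion gives a linear recurrence for x_t^2 of ratio rho^2, whose cross term
    averages to 0. *)
Lemma avg_ar_sq x u (L : R) : x 0%N = 0 -> (forall t, x t.+1 = rho * x t + u t) ->
  avg (fun t => x t * u t) @ \oo --> (0 : R) -> avg (fun t => u t ^+ 2) @ \oo --> L ->
  avg (fun t => x t ^+ 2) @ \oo --> L / (1 - rho ^+ 2).
Proof.
move=> x0 xS xu uu.
apply: (@avg_linear_recurrence _ _ _ _ (fun t => 2 * rho * (x t * u t) + u t ^+ 2)).
- by rewrite ger0_norm ?sqr_ge0// -real_normK ?num_real// expr_lt1.
- by rewrite x0 expr0n.
- by move=> t; rewrite xS; ring.
rewrite (_ : avg _ = fun n => 2 * rho * avg (fun t => x t * u t) n + avg (fun t => u t ^+ 2) n).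
  rewrite -[X in _ --> X]add0r -[X in _ --> X + _](mulr0 (2 * rho)).
  by apply: cvgD => //; apply: cvgM => //; exact: cvg_cst.
by apply/funext => n; rewrite avgD avgZ.
Qed.

End regression.

(** * Uniform convergence of quadratic forms *)

Lemma compact_bound (R : realType) (X : topologicalType) (K : set X) (f : X -> R) :
  compact K -> {in K, continuous f} ->
  exists B : R, forall a, K a -> `|f a| <= B.
Proof.
move=> cK cf.
have /compact_bounded[M [_ MP]] := continuous_compact (continuous_in_subspaceT cf) cK.
exists (M + 1) => a Ka; apply: (MP (M + 1)); first by rewrite ltrDl.
by exists a.
Qed.

Section quadratic_form.
Context {R : realType} {X : Type} {I : finType}.
Variables (gam : X -> I -> R) (s : X -> R).

Definition quad (a : X) (g : I -> I -> R) := s a * \sum_p \sum_q gam a p * gam a q * g p q.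

Lemma quad_cvg_uniform (K : set X) (B : R) (g : nat -> I -> I -> R) (G : I -> I -> R) :
  (forall a, K a -> `|s a| <= B /\ forall p, `|gam a p| <= B) ->
  (forall p q, (fun n => g n p q) @ \oo --> G p q) ->
  forall e : R, 0 < e -> \forall n \near \oo, forall a, K a ->
    `|quad a (g n) - quad a G| < e.
Proof.
move=> KB gG e e0.
have [[a0 Ka0]|K0] := pselect (exists a, K a); last first.
  by near=> n => a Ka; exfalso; apply: K0; exists a.
have B0 : 0 <= B by have [h _] := KB _ Ka0; exact: le_trans h.
pose N : R := \sum_(p : I) \sum_(q : I) 1.
have N0 : 0 <= N by apply: sumr_ge0 => p _; apply: sumr_ge0.
(* N counts the pairs (p, q), so B^3 N bounds the sensitivity of [quad] to an entrywise error;
   adding 1 keeps c positive and the final inequality strict. *)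
pose c := B * (B * B * N) + 1.
have c0 : 0 < c by rewrite /c ltr_wpDl// !mulr_ge0.
have del0 : 0 < e / c by rewrite divr_gt0.
have nearg : \forall n \near \oo, forall p q, `|g n p q - G p q| < e / c.
  apply: filter_forall => p; apply: filter_forall => q.
  by have /cvgrPdistC_lt/(_ _ del0) := gG p q.
apply: filterS nearg => n gn a Ka.
have [sB gB] := KB _ Ka.
rewrite /quad -mulrBr normrM -sumrB.
apply: (@le_lt_trans _ _ (B * (B * B * (e / c) * N))); last first.
  rewrite (_ : B * (B * B * (e / c) * N) = (c - 1) * (e / c)); last by rewrite /c; ring.
  by rewrite -[ltRHS](@divfK _ c) ?gt_eqF// [ltRHS]mulrC ltr_pM2r// ltrBlDr ltrDl.
apply: ler_pM => //; apply: le_trans (ler_norm_sum _ _ _) _.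
rewrite /N mulr_sumr; apply: ler_sum => p _.
rewrite -sumrB; apply: le_trans (ler_norm_sum _ _ _) _.
rewrite mulr_sumr; apply: ler_sum => q _.
rewrite mulr1 -mulrBr !normrM; apply: ler_pM; rewrite ?mulr_ge0//; first exact: ler_pM.
exact: ltW.
Unshelve. all: by end_near. Qed.

End quadratic_form.

Lemma Rintegral_prob_cst d (T : measurableType d) (R : realType) (P : probability T R) (k : R) :
  \int[P]_w k = k.
Proof. by rewrite Rintegral_cst//= probability_setT mulr1. Qed.

Lemma normal_pdf_gt0 (R : realType) (s y : R) : s != 0 -> 0 < normal_pdf 0 s y.
Proof. by move=> s0; rewrite normal_pdfE// mulr_gt0 ?normal_peak_gt0// expR_gt0. Qed.

Lemma ln_normal_pdf (R : realType) (s y : R) : s != 0 ->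
  ln (normal_pdf 0 s y) = ln (normal_peak s) - (s ^+ 2 *+ 2)^-1 * y ^+ 2.
Proof.
move=> s0; rewrite normal_pdfE// lnM ?posrE ?normal_peak_gt0 ?expR_gt0//.
by rewrite expRK subr0 mulNr mulrC.
Qed.

(** * Moments of the process, strong laws and the likelihood ratio *)

Section autoregression.
Context (R : realType) (m : nat) (d : measure_display) (T : measurableType d).
Context (P : probability T R) (eps : nat -> {RV P >-> R}).
Context (z : nat -> 'cV[R]_m.+1) (th0 : @param R m) (Sigma : 'M[R]_m.+1).
Hypothesis indep_eps : indep_pos P (fun t => (eps t : T -> R)).
Hypothesis normal_eps : forall t, (0 < t)%N -> forall A : set R, measurable A ->
  P (eps t @^-1` A) = normal_prob 0 (p_sigma th0) A.
Hypothesis rho1 : `|p_rho th0| < 1.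
Hypothesis zz_lag : forall k, (0 < k)%N ->
  (fun n : nat => n%:R^-1 *: \sum_(1 <= t < n.+1) (z (t + k)%N *m (z t)^T))
       @ \oo --> (0 : 'M[R]_m.+1).
Hypothesis zz : (fun n : nat => n%:R^-1 *: \sum_(1 <= t < n.+1) (z t *m (z t)^T))
    @ \oo --> Sigma.
Hypothesis sigma0 : p_sigma th0 != 0.

Local Notation rho := (p_rho th0).
Local Notation zeta := (covariate z).
Local Notation delta := (drift z (p_beta th0)).
(** Shifted so that [x t] is the lagged value standing next to it, and so that [noise t] is the
    first noise beyond [past eps t]. *)
Let noise t : T -> R := eps t.+1.
Let x t : T -> R := xproc th0 z (fun t => (eps t : T -> R)) t.

Let xS t w : x t.+1 w = rho * x t w + (delta t + noise t w).
Proof. by rewrite /x /= -addrA. Qed.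

Let noise_sq_L2 t : L2 P (fun w => noise t w ^+ 2).
Proof.
split; first exact: measurable_funX.
under [X in EFin \o X]eq_fun do rewrite -exprM.
exact: (normal_integrable_expr4 sigma0 (normal_eps (ltn0Sn t))).
Qed.

Let noise_L2 t : L2 P (noise t).
Proof. by split; [exact: measurable_funP|exact: L2_integrable (noise_sq_L2 t)]. Qed.

Let noise_mean t : \int[P]_w noise t w = 0.
Proof.
apply: (normal_integral0 sigma0 (normal_eps (ltn0Sn t))).
exact: L2_integrable (noise_L2 t).
Qed.

Let eq_noise_integral (g : R -> R) s t :
  measurable_fun setT g -> (forall y, 0 <= g y) ->
  \int[P]_w g (noise s w) = \int[P]_w g (noise t w).
Proof.
move=> mg g0; congr fine.
have mEg : measurable_fun setT (EFin \o g) by exact/measurable_EFinP.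
have Eg0 y : (0 <= (EFin \o g) y)%E by rewrite lee_fin.
rewrite -[LHS](@ge0_integral_distribution _ _ _ _ _ P (eps s.+1) (EFin \o g))//.
rewrite -[RHS](@ge0_integral_distribution _ _ _ _ _ P (eps t.+1) (EFin \o g))//.
apply: eq_measure_integral => A mA _.
rewrite -[LHS]/(P (eps s.+1 @^-1` A)) -[RHS]/(P (eps t.+1 @^-1` A)).
by rewrite !normal_eps.
Qed.

Let v := \int[P]_w (noise 0 w ^+ 2).

Let noise_var t : \int[P]_w (noise t w ^+ 2) = v.
Proof.
by apply: (@eq_noise_integral (fun y => y ^+ 2)) => [|y]; [exact: measurable_funX|exact: sqr_ge0].
Qed.

Let v_ge0 : 0 <= v.
Proof. by apply: Rintegral_ge0 => w _; exact: sqr_ge0. Qed.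

Let x_L2 t : L2 P (x t).
Proof.
elim: t => [|t IH]; first exact: L2_cst.
rewrite (_ : x t.+1 = fun w => rho * x t w + (delta t + noise t w)).
  by apply: L2D; [exact: L2Z|apply: L2D => //; exact: L2_cst].
by apply/funext => w; rewrite xS.
Qed.

Let x_past n t : (t <= n)%N -> past_measurable eps n (x t).
Proof.
elim: t => [|t IH] tn; first exact: past_measurable_cst.
rewrite (_ : x t.+1 = fun w => rho * x t w + (delta t + noise t w)).
  apply: past_measurableD.
    by apply: past_measurableM; [exact: past_measurable_cst|apply: IH; exact: ltnW].
  apply: past_measurableD; first exact: past_measurable_cst.
  exact: past_measurable_noise.
by apply/funext => w; rewrite xS.
Qed.

Let noise_past n t : (t < n)%N -> past_measurable eps n (noise t).
Proof. by move=> tn; exact: past_measurable_noise. Qed.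

Let integral_past_noise t F : past_measurable eps t F ->
  P.-integrable setT (EFin \o F) -> \int[P]_w (F w * noise t w) = 0.
Proof.
move=> pF iF.
have [_ ->] := integral_pastM indep_eps (g := id) pF (@measurable_id _ _ _)
  iF (L2_integrable (noise_L2 t)).
by rewrite noise_mean mulr0.
Qed.

(** A product of two square integrable variables is in general only integrable; here x_t^2 and the
    squared noise are independent, so their product is integrable too. *)
Let x_noise_L2 t : L2 P (fun w => x t w * noise t w) /\
  \int[P]_w ((x t w * noise t w) ^+ 2) = \int[P]_w (x t w ^+ 2) * v.
Proof.
have m2 : measurable_fun setT (fun y : R => y ^+ 2) by exact: measurable_funX.
have p2 : past_measurable eps t (fun w => x t w ^+ 2).
  by apply: past_measurableM; exact: x_past.
have [i2 E2] := integral_pastM indep_eps p2 m2 (proj2 (x_L2 t)) (proj2 (noise_L2 t)).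
split; first split.
- by apply: measurable_funM; [case: (x_L2 t)|case: (noise_L2 t)].
- by under [X in EFin \o X]eq_fun do rewrite exprMn.
- under eq_Rintegral do rewrite exprMn.
  by rewrite -(noise_var t) -E2.
Qed.

Let mean t := \int[P]_w x t w.
Let power t := \int[P]_w (x t w ^+ 2).

Let mean0 : mean 0 = 0.
Proof. by rewrite /mean Rintegral_prob_cst. Qed.

Let meanS t : mean t.+1 = rho * mean t + delta t.
Proof.
rewrite /mean; under eq_Rintegral do rewrite xS.
have ix := L2_integrable (x_L2 t); have ie := L2_integrable (noise_L2 t).
have ic := integrable_cst_fun P (delta t).
rewrite RintegralD//; last 2 first.
- exact: integrableZ_fun.
- exact: integrableD_fun.
by rewrite RintegralZl// RintegralD// noise_mean addr0 Rintegral_prob_cst.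
Qed.

Let power0 : power 0 = 0.
Proof. by rewrite /power; under eq_Rintegral do rewrite expr0n/=; rewrite Rintegral_prob_cst. Qed.

Let powerS t :
  power t.+1 = rho ^+ 2 * power t + (2 * rho * (mean t * delta t) + (delta t ^+ 2 + v)).
Proof.
rewrite /power /mean.
have ix := L2_integrable (x_L2 t); have ie := L2_integrable (noise_L2 t).
have [_ ix2] := x_L2 t; have [_ ie2] := noise_L2 t.
have ixe := L2M (x_L2 t) (noise_L2 t).
have ic := integrable_cst_fun P (delta t ^+ 2).
transitivity (\int[P]_w (rho ^+ 2 * x t w ^+ 2 + (2 * rho * delta t * x t w +
   (delta t ^+ 2 + (noise t w ^+ 2 + (2 * rho * (x t w * noise t w)
     + 2 * delta t * noise t w)))))).
  by apply: eq_Rintegral => w _; rewrite xS; ring.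
rewrite RintegralD//; last 2 first.
- exact: integrableZ_fun.
- do 4 (apply: integrableD_fun => //; try exact: integrableZ_fun).
rewrite RintegralD//; last 2 first.
- exact: integrableZ_fun.
- do 3 (apply: integrableD_fun => //; try exact: integrableZ_fun).
rewrite RintegralD//; last first.
  do 2 (apply: integrableD_fun => //; try exact: integrableZ_fun).
rewrite RintegralD//; last first.
  by apply: integrableD_fun; exact: integrableZ_fun.
rewrite RintegralD//; [|exact: integrableZ_fun|exact: integrableZ_fun].
rewrite Rintegral_prob_cst !RintegralZl// noise_mean integral_past_noise//; last exact: x_past.
by rewrite noise_var; ring.
Qed.

Let D := drift_energy Sigma (p_beta th0).

Let delta_sq_bound : exists U : R, forall n, \sum_(0 <= t < n) delta t ^+ 2 <= U * n%:R.
Proof. by apply: (@sum_le_of_cvg_avg _ _ D); exact: avg_drift_sq. Qed.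

Let avg_mean_covariate i : avg (fun t => mean t * zeta i t) @ \oo --> (0 : R).
Proof.
apply: (avg_ar_covariate zz rho1 mean0 meanS delta_sq_bound) => k.
exact: avg_drift_lag.
Qed.

(** The recursion for E x_t^2 is coupled to the mean only through mean times drift, which averages
    to 0. The limit supplies both a Gram entry in expectation and the variance bound for x_t times
    noise. *)
Let avg_power : avg power @ \oo --> (D + v) / (1 - rho ^+ 2).
Proof.
apply: (avg_linear_recurrence _ power0 powerS).
  by rewrite ger0_norm ?sqr_ge0// -real_normK ?num_real// expr_lt1.
rewrite (_ : avg _ = fun n => 2 * rho * avg (fun t => delta t * mean t) n +
    (avg (fun t => delta t ^+ 2) n + avg (fun=> v) n)).
  rewrite -[X in _ --> X]add0r -[X in _ --> X + _](mulr0 (2 * rho)).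
  apply: cvgD.
    apply: cvgM; first exact: cvg_cst.
    apply: avg_drift_cvg0 => i; rewrite (_ : (fun t => _) = fun t => mean t * zeta i t) //.
    by apply/funext => t; rewrite mulrC.
  by apply: cvgD; [exact: avg_drift_sq|exact: cvg_avg_cst].
apply/funext => n; rewrite avgD avgZ avgD; congr (_ * avg _ _ + _).
by apply/funext => t; rewrite mulrC.
Qed.

Let slln_noise_sq : {ae P, forall w, avg (fun t => noise t w ^+ 2) @ \oo --> v}.
Proof.
pose g (y : R) := y ^+ 2 - v.
have mg : measurable_fun setT g.
  by apply: measurable_funB => //; exact: measurable_funX.
have Lg t : L2 P (fun w => g (noise t w)) by apply: L2D => //; exact: L2_cst.
have Eg t : \int[P]_w g (noise t w) = 0.
  rewrite /g RintegralB//; last exact: integrable_cst_fun.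
    by rewrite noise_var Rintegral_prob_cst subrr.
  exact: L2_integrable (noise_sq_L2 t).
have orth s t : (s < t)%N -> \int[P]_w (g (noise s w) * g (noise t w)) = 0.
  move=> st.
  have pg : past_measurable eps t (fun w => g (noise s w)).
    apply: past_measurableD; last exact: past_measurable_cst.
    by apply: past_measurableM; exact: noise_past.
  have [_ ->] := integral_pastM indep_eps pg mg (L2_integrable (Lg s)) (L2_integrable (Lg t)).
  by rewrite !Eg mulr0.
have var n : \sum_(0 <= t < n) \int[P]_w (g (noise t w) ^+ 2) <=
    \int[P]_w (g (noise 0 w) ^+ 2) * n%:R.
  rewrite (eq_bigr (fun=> \int[P]_w (g (noise 0 w) ^+ 2))); last first.
    move=> t _; apply: (@eq_noise_integral (fun y => g y ^+ 2)) => [|y]; last exact: sqr_ge0.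
    exact: measurable_funX.
  by rewrite sumr_const_nat subn0 mulr_natr.
apply: filterS (@orthogonal_slln _ _ _ P _ _ Lg orth var) => w gw.
rewrite (_ : avg _ = fun n => avg (fun t => g (noise t w)) n + avg (fun=> v) n).
  by rewrite -[X in _ --> X]add0r; apply: cvgD => //; exact: cvg_avg_cst.
apply/funext => n; rewrite -avgD; congr avg.
by apply/funext => t; rewrite /g subrK.
Qed.

(** Lag 0 gives a Gram entry; positive lags are what [ar_cross_avg] asks of the input along a
    path. *)
Let slln_noise_covariate i k :
  {ae P, forall w, avg (fun t => noise t w * zeta i (t + k)) @ \oo --> (0 : R)}.
Proof.
have Lx t : L2 P (fun w => zeta i (t + k) * noise t w) by exact: L2Z.
have orth s t : (s < t)%N ->
    \int[P]_w (zeta i (s + k) * noise s w * (zeta i (t + k) * noise t w)) = 0.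
  move=> st; under eq_Rintegral do rewrite mulrA.
  apply: integral_past_noise.
    apply: past_measurableM; last exact: past_measurable_cst.
    by apply: past_measurableM; [exact: past_measurable_cst|exact: noise_past].
  under [X in EFin \o X]eq_fun do rewrite mulrC.
  exact/integrableZ_fun/L2_integrable.
have [M MP] := covariate_sq_bound zz i.
have M0 : 0 <= M by have := MP 1%N; rewrite big_nat1 mulr1; apply: le_trans; exact: sqr_ge0.
(* The factor k+1 comes from n + k <= (k+1) n for n >= 1. *)
have var n : \sum_(0 <= t < n) \int[P]_w ((zeta i (t + k) * noise t w) ^+ 2) <=
    v * (M * k.+1%:R) * n%:R.
  rewrite (eq_bigr (fun t => v * zeta i (t + k) ^+ 2)); last first.
    move=> t _; under eq_Rintegral do rewrite exprMn.
    by rewrite RintegralZl ?noise_var 1?mulrC//; case: (noise_L2 t).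
  rewrite -mulr_sumr -mulrA ler_wpM2l//.
  have [->|n0] := posnP n; first by rewrite big_nil mulr0.
  have -> : \sum_(0 <= t < n) zeta i (t + k) ^+ 2 = \sum_(k <= t < n + k) zeta i t ^+ 2.
    by rewrite -{2}(add0n k) big_addn addnK.
  apply: (@le_trans _ _ (M * (n + k)%:R)).
    apply: le_trans (MP _); rewrite [leRHS](@big_cat_nat _ _ _ k)//= ?leq_addl//.
    by rewrite lerDr sumr_ge0// => t _; exact: sqr_ge0.
  by rewrite -mulrA ler_wpM2l// -natrM ler_nat; nia.
apply: filterS (@orthogonal_slln _ _ _ P _ _ Lx orth var) => w.
by rewrite (_ : (fun t => _) = (fun t => noise t w * zeta i (t + k)))//;
  apply/funext => t; rewrite mulrC.
Qed.

Let slln_ar_noise : {ae P, forall w, avg (fun t => x t w * noise t w) @ \oo --> (0 : R)}.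
Proof.
have Lx t : L2 P (fun w => x t w * noise t w) by have [] := x_noise_L2 t.
have orth s t : (s < t)%N -> \int[P]_w (x s w * noise s w * (x t w * noise t w)) = 0.
  move=> st; under eq_Rintegral do rewrite mulrA.
  apply: integral_past_noise; last exact: L2M.
  apply: past_measurableM; last exact: x_past.
  by apply: past_measurableM; [apply: x_past; exact: ltnW|exact: noise_past].
have [M MP] := sum_le_of_cvg_avg avg_power.
have var n : \sum_(0 <= t < n) \int[P]_w ((x t w * noise t w) ^+ 2) <= v * M * n%:R.
  rewrite (eq_bigr (fun t => v * power t)); last first.
    by move=> t _; rewrite mulrC; have [] := x_noise_L2 t.
  by rewrite -mulr_sumr -mulrA ler_wpM2l.
exact: (@orthogonal_slln _ _ _ P _ _ Lx orth var).
Qed.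

Local Notation I := ('I_m.+1 + bool)%type.

(* inl i is the i-th covariate, inr true the lagged process, inr false the noise. *)
Let regressor (p : I) t w : R :=
  match p with inl i => zeta i t | inr b => if b then x t w else noise t w end.

(** As its lagged averages vanish, the drift acts like white noise of variance D, whence D + v over
    1 - rho^2, the second moment of a stationary autoregression. *)
Let gram (p q : I) : R :=
  match p, q with
  | inl i, inl j => Sigma i j
  | inr true, inr true => (D + v) / (1 - rho ^+ 2)
  | inr false, inr false => v
  | _, _ => 0
  end.

Let avg_gram_ae : {ae P, forall w, forall p q,
  avg (fun t => regressor p t w * regressor q t w) @ \oo --> gram p q}.
Proof.
have ez : {ae P, forall w, forall i k,
    avg (fun t => noise t w * zeta i (t + k)) @ \oo --> (0 : R)}.
  apply: filter_forall => i; apply: ae_foralln => k; exact: slln_noise_covariate.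
apply: filterS (filterI slln_noise_sq (filterI ez slln_ar_noise)) => w [ee [{}ez xe]].
(* From here on w is fixed and the argument is deterministic, with u the whole input of the
   recursion. *)
pose u t := delta t + noise t w.
have ze i : avg (fun t => zeta i t * noise t w) @ \oo --> (0 : R).
  rewrite (_ : (fun t => _) = (fun t => noise t w * zeta i (t + 0))); first exact: ez.
  by apply/funext => t; rewrite addn0 mulrC.
have uu : avg (fun t => u t ^+ 2) @ \oo --> D + v.
  rewrite (_ : avg _ = fun n => avg (fun t => delta t ^+ 2) n +
      2 * avg (fun t => delta t * noise t w) n + avg (fun t => noise t w ^+ 2) n).
    apply: cvgD => //; rewrite -[X in _ --> X]addr0; apply: cvgD; first exact: avg_drift_sq.
    rewrite -[X in _ --> X](mulr0 2); apply: cvgM; first exact: cvg_cst.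
    exact: avg_drift_cvg0.
  apply/funext => n; rewrite -avgZ -!avgD; congr avg.
  by apply/funext => t; rewrite /u; ring.
have uz i k : avg (fun t => u t * zeta i (t + k.+1)) @ \oo --> (0 : R).
  rewrite (_ : avg _ = fun n => avg (fun t => delta t * zeta i (t + k.+1)) n +
      avg (fun t => noise t w * zeta i (t + k.+1)) n).
    by rewrite -[X in _ --> X]addr0; apply: cvgD; [exact: avg_drift_lag|exact: ez].
  apply/funext => n; rewrite -avgD; congr avg.
  by apply/funext => t; rewrite /u mulrDl.
have x0 : x 0 w = 0 by [].
have xSw t : x t.+1 w = rho * x t w + u t by exact: xS.
have uU : exists U : R, forall n, \sum_(0 <= t < n) u t ^+ 2 <= U * n%:R.
  exact: sum_le_of_cvg_avg uu.
have xz i : avg (fun t => x t w * zeta i t) @ \oo --> (0 : R).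
  by apply: (avg_ar_covariate zz rho1 x0 xSw uU) => k; exact: uz.
have zx i : avg (fun t => zeta i t * x t w) @ \oo --> (0 : R).
  rewrite (_ : (fun t => _) = (fun t => x t w * zeta i t))//.
  by apply/funext => t; rewrite mulrC.
have xu : avg (fun t => x t w * u t) @ \oo --> (0 : R).
  rewrite (_ : avg _ = fun n => avg (fun t => delta t * x t w) n + avg (fun t => x t w * noise t w) n).
    by rewrite -[X in _ --> X]addr0; apply: cvgD => //; exact: avg_drift_cvg0.
  apply/funext => n; rewrite -avgD; congr avg.
  by apply/funext => t; rewrite /u; ring.
have xx := avg_ar_sq rho1 x0 xSw xu uu.
case=> [i|[]] [j|[]] /=.
- exact: avg_covariate.
- exact: zx.
- exact: ze.
- exact: xz.
- by under [X in avg X]eq_fun do rewrite -expr2.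
- exact: xe.
- rewrite (_ : (fun t => _) = (fun t => zeta j t * noise t w)); first exact: ze.
  by apply/funext => t; rewrite mulrC.
- rewrite (_ : (fun t => _) = (fun t => x t w * noise t w)); first exact: xe.
  by apply/funext => t; rewrite mulrC.
- by under [X in avg X]eq_fun do rewrite -expr2.
Qed.

Let regressor_L2 p t : L2 P (regressor p t).
Proof. by case: p => [i|[]] /=; [exact: L2_cst|exact: x_L2|exact: noise_L2]. Qed.

Let avg_gram_mean p q :
  avg (fun t => \int[P]_w (regressor p t w * regressor q t w)) @ \oo --> gram p q.
Proof.
have cst0 (f : nat -> R) : (forall t, f t = 0) -> avg f @ \oo --> (0 : R).
  by move=> f0; rewrite (_ : f = fun=> 0); [exact: cvg_avg_cst|exact/funext].
have Exe t : \int[P]_w (x t w * noise t w) = 0.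
  apply: integral_past_noise; first exact: x_past.
  exact: L2_integrable.
have Eze i t : \int[P]_w (zeta i t * noise t w) = 0.
  by rewrite RintegralZl ?noise_mean ?mulr0//; exact: L2_integrable.
have Exz i t : \int[P]_w (x t w * zeta i t) = mean t * zeta i t.
  by rewrite RintegralZr//; exact: L2_integrable.
case: p q => [i|[]] [j|[]] /=.
- rewrite (_ : (fun t => _) = (fun t => zeta i t * zeta j t)); first exact: avg_covariate.
  by apply/funext => t; rewrite Rintegral_prob_cst.
- rewrite (_ : (fun t => _) = (fun t => mean t * zeta i t)); first exact: avg_mean_covariate.
  by apply/funext => t; rewrite -Exz; apply: eq_Rintegral => w _; rewrite mulrC.
- by apply: cst0 => t; exact: Eze.
- rewrite (_ : (fun t => _) = (fun t => mean t * zeta j t)); first exact: avg_mean_covariate.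
  by apply/funext => t; rewrite Exz.
- rewrite (_ : (fun t => _) = power); first exact: avg_power.
  by apply/funext => t; apply: eq_Rintegral => w _; rewrite expr2.
- by apply: cst0 => t; exact: Exe.
- by apply: cst0 => t; rewrite -(Eze j t); apply: eq_Rintegral => w _; rewrite mulrC.
- by apply: cst0 => t; rewrite -(Exe t); apply: eq_Rintegral => w _; rewrite mulrC.
- rewrite (_ : (fun t => _) = (fun=> v)); first exact: cvg_avg_cst.
  by apply/funext => t; rewrite -(noise_var t); apply: eq_Rintegral => w _; rewrite expr2.
Qed.

Let coef (th : @param R m) (p : I) : R :=
  match p with
  | inl i => p_beta th0 i 0 - p_beta th i 0
  | inr b => if b then rho - p_rho th else 1
  end.

Let residualE th t w : x t.+1 w - p_rho th * x t w - dotc (z t.+1) (p_beta th) =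
  \sum_p coef th p * regressor p t w.
Proof.
rewrite big_sumType big_bool/= xS.
rewrite (eq_bigr (fun i => p_beta th0 i 0 * zeta i t - p_beta th i 0 * zeta i t)).
  by rewrite sumrB -driftE -driftE /drift; ring.
by move=> i _; rewrite mulrBl.
Qed.

Let prec (th : @param R m) : R := (p_sigma th ^+ 2 *+ 2)^-1.
Let logpeak (th : @param R m) : R := ln (normal_peak (p_sigma th)).
Let logR th n w := logRn th0 z (fun t => (eps t : T -> R)) th n w.

Let logRE th n w : p_sigma th != 0 ->
  logR th n w = \sum_(0 <= t < n) (logpeak th - logpeak th0
    + prec th0 * noise t w ^+ 2 - prec th * (\sum_p coef th p * regressor p t w) ^+ 2).
Proof.
move=> s0; rewrite /logR /logRn /fdens !big_add1/=.
pose a t := normal_pdf 0 (p_sigma th) (x t.+1 w - p_rho th * x t w - dotc (z t.+1) (p_beta th)).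
pose b t := normal_pdf 0 (p_sigma th0) (x t.+1 w - rho * x t w - dotc (z t.+1) (p_beta th0)).
rewrite -[LHS]/(ln ((\prod_(0 <= t < n) a t) / (\prod_(0 <= t < n) b t))).
have a0 t : 0 < a t by exact: normal_pdf_gt0.
have b0 t : 0 < b t by exact: normal_pdf_gt0.
elim: n => [|n IH]; first by rewrite !big_nil divr1 ln1.
rewrite !big_nat_recr//= -IH invfM mulrACA lnM ?posrE ?divr_gt0 ?prodr_gt0//.
congr (_ + _); rewrite ln_div ?posrE// !ln_normal_pdf// residualE.
rewrite (_ : x n.+1 w - _ - _ = noise n w); last by rewrite xS /drift; ring.
by rewrite -/(logpeak th) -/(logpeak th0) -/(prec th) -/(prec th0); ring.
Qed.

Let rate (th : @param R m) (g : I -> I -> R) : R :=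
  logpeak th - logpeak th0 + prec th0 * g (inr false) (inr false) - quad coef prec th g.

(** An exact identity, so path and expectation limits are limits of the same function [rate th]. The
    index is n+1 because an empty average of the constant part would be 0. *)
Let avg_logR th n w : p_sigma th != 0 ->
  n.+1%:R^-1 * logR th n.+1 w =
  rate th (fun p q => avg (fun t => regressor p t w * regressor q t w) n.+1).
Proof.
move=> s0; rewrite logRE// -/(avg _ _) /rate /quad.
set k0 := logpeak th - logpeak th0; rewrite -[k0 in RHS](avg_cst k0 n) -[in RHS]avgZ.
under eq_bigr do under eq_bigr do rewrite -avgZ.
under eq_bigr do rewrite -avg_sum.
rewrite -avg_sum -avgZ -mulN1r -avgZ -!avgD; congr avg.
apply/funext => t /=; rewrite mulN1r expr2; congr (_ + _ - _ * _).
rewrite expr2 mulr_suml; apply: eq_bigr => p _.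
by rewrite mulr_sumr; apply: eq_bigr => q _; ring.
Qed.

Let integrable_avg p q n : P.-integrable setT
  (EFin \o (fun w => avg (fun t => regressor p t w * regressor q t w) n)).
Proof. by apply/integrableZ_fun/integrable_sum_fun => t; exact: L2M. Qed.

Let integral_avg p q n : \int[P]_w avg (fun t => regressor p t w * regressor q t w) n =
  avg (fun t => \int[P]_w (regressor p t w * regressor q t w)) n.
Proof.
rewrite /avg RintegralZl//; last by apply: integrable_sum_fun => t; exact: L2M.
by rewrite Rintegral_sum_fun// => t; exact: L2M.
Qed.

(** [rate th] is affine in the Gram matrix, so expectation passes inside it. *)
Let integral_rate th n :
  let f w := rate th (fun p q => avg (fun t => regressor p t w * regressor q t w) n) in
  P.-integrable setT (EFin \o f) /\ \int[P]_w f w =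
  rate th (fun p q => avg (fun t => \int[P]_w (regressor p t w * regressor q t w)) n).
Proof.
pose A p q w := avg (fun t => regressor p t w * regressor q t w) n.
pose k0 := logpeak th - logpeak th0.
have iA p q : P.-integrable setT (EFin \o A p q) by exact: integrable_avg.
have iq p q : P.-integrable setT (EFin \o (fun w => coef th p * coef th q * A p q w)).
  exact: integrableZ_fun.
have iQ : P.-integrable setT (EFin \o
    (fun w => \sum_p \sum_q coef th p * coef th q * A p q w)).
  by apply: integrable_sum_fun => p; exact: integrable_sum_fun.
have ik : P.-integrable setT (EFin \o (fun w => k0 + prec th0 * A (inr false) (inr false) w)).
  by apply: integrableD_fun; [exact: integrable_cst_fun|exact: integrableZ_fun].
have iQ' := integrableZ_fun (- prec th) iQ.
have fE w : rate th (fun p q => A p q w) = k0 + prec th0 * A (inr false) (inr false) w +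
    - prec th * \sum_p \sum_q coef th p * coef th q * A p q w.
  by rewrite /rate /quad mulNr.
rewrite /=; split.
  rewrite (_ : (fun w => _) = fun w => k0 + prec th0 * A (inr false) (inr false) w +
    - prec th * \sum_p \sum_q coef th p * coef th q * A p q w).
    exact: integrableD_fun.
  by apply/funext => w; rewrite fE.
transitivity (\int[P]_w (k0 + prec th0 * A (inr false) (inr false) w +
    - prec th * \sum_p \sum_q coef th p * coef th q * A p q w)).
  by apply: eq_Rintegral => w _; exact: fE.
rewrite RintegralD// RintegralD//; last 2 first.
- exact: integrable_cst_fun.
- exact: integrableZ_fun.
have EA p q : \int[P]_w A p q w =
  avg (fun t => \int[P]_w (regressor p t w * regressor q t w)) n by exact: integral_avg.
rewrite Rintegral_prob_cst RintegralZl// EA RintegralZl//.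
rewrite Rintegral_sum_fun; last by move=> p; exact: integrable_sum_fun.
rewrite mulNr /rate /quad; congr (_ - _ * _); apply: eq_bigr => p _.
rewrite Rintegral_sum_fun//; apply: eq_bigr => q _.
by rewrite RintegralZl// EA.
Qed.

(** The log peaks cancel in the difference, so compactness has only to bound [coef] and [prec]; the
    latter is continuous on K because sigma is positive there. *)
Let rate_cvg_uniform (K : set (@param R m)) (g : nat -> I -> I -> R) :
  compact K -> K `<=` Theta ->
  (forall p q, (fun n => g n p q) @ \oo --> gram p q) ->
  forall e : R, 0 < e -> \forall n \near \oo, forall th, K th ->
    `|rate th (g n) - rate th gram| < e.
Proof.
move=> cK KT gG e e0.
have cs : continuous (fun th : @param R m => p_sigma th) by move=> th; exact: cvg_snd.
have cr : continuous (fun th : @param R m => p_rho th).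
  by move=> th; apply: (@cvg_comp _ _ _ fst fst); exact: cvg_fst.
have cb i : continuous (fun th : @param R m => p_beta th i 0).
  move=> th; apply: (@cvg_comp _ _ _ (fun th : @param R m => p_beta th) (fun M : 'cV[R]_m.+1 => M i 0)).
    by apply: (@cvg_comp _ _ _ fst snd); [exact: cvg_fst|exact: cvg_snd].
  exact: coord_continuous.
have [Bs sB] : exists B : R, forall th, K th -> `|prec th| <= B.
  apply: compact_bound => // th /set_mem Kth.
  apply: cvgV; first by rewrite mulrn_eq0/= expf_eq0/= gt_eqF//; exact: KT.
  by apply: cvgMn; apply: cvgM; exact: cs.
have /choice[Bp pB] : forall p, exists B : R, forall th, K th -> `|coef th p| <= B.
  move=> [i|[]] /=.
  - by apply: compact_bound => // th _; apply: cvgB; [exact: cvg_cst|exact: cb].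
  - by apply: compact_bound => // th _; apply: cvgB; [exact: cvg_cst|exact: cr].
  - by exists 1 => th _; rewrite normr1.
pose B := `|Bs| + \sum_p `|Bp p|.
have sum0 : 0 <= \sum_p `|Bp p| by exact: sumr_ge0.
have KB th : K th -> `|prec th| <= B /\ forall p, `|coef th p| <= B.
  move=> Kth; split=> [|p].
    by rewrite (le_trans (sB _ Kth))// (le_trans (ler_norm _))// lerDl.
  rewrite (le_trans (pB p _ Kth))// (le_trans (ler_norm _))// /B (bigD1 p)//=.
  by rewrite addrCA lerDl addr_ge0// sumr_ge0.
have e2 : 0 < e / 2 by rewrite divr_gt0.
have d0 : 0 < e / 2 / (`|prec th0| + 1) by rewrite divr_gt0// ltr_wpDl.
have h1 := quad_cvg_uniform KB gG e2.
have h2 : \forall n \near \oo, `|g n (inr false) (inr false) - gram (inr false) (inr false)|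
    < e / 2 / (`|prec th0| + 1).
  by have /cvgrPdistC_lt/(_ _ d0) := gG (inr false) (inr false).
apply: filterS2 h1 h2 => n h1 h2 th Kth.
have -> : rate th (g n) - rate th gram =
    prec th0 * (g n (inr false) (inr false) - gram (inr false) (inr false))
    - (quad coef prec th (g n) - quad coef prec th gram) by rewrite /rate; ring.
rewrite (le_lt_trans (ler_normB _ _))// (splitr e) ler_ltD//; last exact: h1.
rewrite normrM; move: h2; rewrite ltr_pdivlMr ?ltr_wpDl// => /ltW; apply: le_trans.
by rewrite mulrC ler_wpM2l// lerDl.
Qed.

Lemma ar_relative_aep : exists h : @param R m -> R,
    (forall th, Theta th ->
       (fun n : nat => ((n%:R^-1)%:E *
          \int[P]_w (- logRn th0 z (fun t => (eps t : T -> R)) th n w)%:E)%E)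
         @ \oo --> (h th)%:E) /\
    (forall th, Theta th ->
       {ae P, forall w,
          (fun n : nat => n%:R^-1 * logRn th0 z (fun t => (eps t : T -> R)) th n w)
            @ \oo --> - h th}) /\
    (forall K : set (@param R m), compact K -> K `<=` Theta ->
       {ae P, forall w, forall e : R, 0 < e ->
          \forall n \near \oo, forall th, K th ->
            `| n%:R^-1 * logRn th0 z (fun t => (eps t : T -> R)) th n w + h th| < e}).
Proof.
(* The pointwise almost sure limit is the case of a singleton K. *)
have unif K : compact K -> K `<=` Theta -> {ae P, forall w, forall e : R, 0 < e ->
    \forall n \near \oo, forall th, K th -> `| n%:R^-1 * logR th n w + - rate th gram| < e}.
  move=> cK KT; apply: filterS avg_gram_ae => w gw e e0.
  have := rate_cvg_uniform cK KT gw e0.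
  have n0 : \forall n \near \oo, (0 < n)%N by exists 1%N.
  apply: filterS2 n0 => -[//|n] _ h th Kth.
  by rewrite avg_logR ?gt_eqF//; [exact: h|exact: KT].
exists (fun th => - rate th gram); split; [|split => //].
- move=> th Tth; have s0 : p_sigma th != 0 by rewrite gt_eqF.
  pose E n p q := avg (fun t => \int[P]_w (regressor p t w * regressor q t w)) n.
  have intE n : (n.+1%:R^-1%:E * \int[P]_w (- logR th n.+1 w)%:E)%E = (- rate th (E n.+1))%:E.
    have [ir Er] := integral_rate th n.+1.
    rewrite (eq_integral (fun w => (- n.+1%:R * rate th
       (fun p q => avg (fun t => regressor p t w * regressor q t w) n.+1))%:E)); last first.
      by move=> w _; rewrite -avg_logR// mulNr mulVKf// pnatr_eq0.
    rewrite -(fineK (integrable_fin_num _ (integrableZ_fun (- n.+1%:R) ir)))// -EFinM.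
    congr EFin; rewrite -[fine _]/(\int[P]_w (- n.+1%:R * rate th _)).
    by rewrite RintegralZl// Er mulNr mulrN mulKf// pnatr_eq0.
  apply/fine_cvgP; split; first by exists 1%N => // -[//|n] _; rewrite /= intE.
  apply/cvgrPdist_lt => e e0.
  have KT : [set th] `<=` Theta by move=> _ ->.
  have := rate_cvg_uniform (@compact_set1 _ th) KT avg_gram_mean e0.
  have n0 : \forall n \near \oo, (0 < n)%N by exists 1%N.
  apply: filterS2 n0 => -[//|n] _ /(_ th erefl) h.
  by rewrite /= intE/= opprK addrC.
- move=> th Tth.
  have KT : [set th] `<=` Theta by move=> _ ->.
  apply: filterS (unif _ (@compact_set1 _ th) KT) => w h.
  rewrite opprK; apply/cvgrPdistC_lt => e e0.
  by apply: filterS (h _ e0) => n; apply.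
Qed.

End autoregression.

Theorem theorem12 (R : realType) (m : nat) (d : measure_display)
  (T : measurableType d) (P : probability T R)
  (eps : nat -> {RV P >-> R})
  (z : nat -> 'cV[R]_m.+1) (th0 : @param R m) (Sigma_z : 'M[R]_m.+1) :
  (* eps_t (t >= 1) i.i.d. N(0, sigma0^2) *)
  indep_pos P (fun t => (eps t : T -> R)) ->
  (forall t, (0 < t)%N -> forall A : set R, measurable A ->
     P (eps t @^-1` A) = normal_prob 0 (p_sigma th0) A) ->
  (* |rho0| < 1 *)
  `|p_rho th0| < 1 ->
  (* (AR-B1) *)
  (fun n : nat => n%:R^-1 *: \sum_(1 <= t < n.+1) z t) @ \oo --> (0 : 'cV[R]_m.+1) ->
  (forall k, (0 < k)%N ->
     (fun n : nat => n%:R^-1 *: \sum_(1 <= t < n.+1) (z (t + k)%N *m (z t)^T))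
       @ \oo --> (0 : 'M[R]_m.+1)) ->
  (fun n : nat => n%:R^-1 *: \sum_(1 <= t < n.+1) (z t *m (z t)^T))
    @ \oo --> Sigma_z ->
  (* (AR-B2) *)
  (exists C : R, 0 < C /\ forall t, (0 < t)%N -> `|dotc (z t) (p_beta th0)| < C) ->
  (* (AR-B3): theta0 interior point of Theta *)
  (interior Theta) th0 ->
  exists h : @param R m -> R,
    (* h is the KL divergence rate: h(th) = lim n^-1 E_P[- log R_n(th)] *)
    (forall th, Theta th ->
       (fun n : nat => ((n%:R^-1)%:E *
          \int[P]_w (- logRn th0 z (fun t => (eps t : T -> R)) th n w)%:E)%E)
         @ \oo --> (h th)%:E) /\
    (* relative AEP, pointwise in theta *)
    (forall th, Theta th ->
       {ae P, forall w,
          (fun n : nat => n%:R^-1 * logRn th0 z (fun t => (eps t : T -> R)) th n w)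
            @ \oo --> - h th}) /\
    (* uniformly over compact subsets of Theta *)
    (forall K : set (@param R m), compact K -> K `<=` Theta ->
       {ae P, forall w, forall e : R, 0 < e ->
          \forall n \near \oo, forall th, K th ->
            `| n%:R^-1 * logRn th0 z (fun t => (eps t : T -> R)) th n w + h th| < e}).
Proof.
move=> indep normal rho1 _ zz_lag zz _ /interior_subset th0_pos.
by apply: ar_relative_aep zz_lag zz _ => //; rewrite gt_eqF.
Qed.
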